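(* If $G\in\mathcal{G}^*$, then $\chi'_l(G)=\chi'(G)$.
   Context: All graphs are simple. $\mathcal{G}^*$ denotes the class of graphs $G$ such that any two distinct odd cycles $C_1,C_2$ of $G$ satisfy $|E(C_1)\cap E(C_2)|\le 1$. $\chi'(G)$ is the chromatic index of $G$. $\chi'_l(G)$ is the list chromatic index of $G$: the least $k$ such that for every assignment of lists of size at least $k$ to the edges of $G$ there is a proper edge-coloring choosing each edge's color from its list. *)

(* Defs.v *)
From mathcomp Require Import all_boot.
Set Implicit Arguments. Unset Strict Implicit. Unset Printing Implicit Defensive.

Section Graphs.
Variables (T : finType) (e : rel T).
(* A simple graph is given by a symmetric irreflexive relation e on a finite
   vertex type T; edges are the 2-element vertex sets {x,y} with e x y. *)

Definition edges : {set {set T}} :=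
  [set A : {set T} | [exists x, exists y, e x y && (A == [set x; y])]].

Definition is_cycle (p : seq T) : bool := ucycleb e p && (2 < size p).

Definition odd_cycle (p : seq T) : bool := is_cycle p && odd (size p).

Definition cycle_edges (p : seq T) : {set {set T}} :=
  [set [set x; next p x] | x in p].

Definition in_Gstar : Prop :=
  forall p q : seq T, odd_cycle p -> odd_cycle q ->
    cycle_edges p != cycle_edges q ->
    #|cycle_edges p :&: cycle_edges q| <= 1.

Definition proper_edge_coloring (c : {set T} -> nat) : Prop :=
  forall A B, A \in edges -> B \in edges -> A != B ->
    A :&: B != set0 -> c A != c B.

Definition edge_colorable (k : nat) : Prop :=
  exists c, proper_edge_coloring c /\ forall A, A \in edges -> c A < k.

Definition edge_choosable (k : nat) : Prop :=
  forall L : {set T} -> seq nat,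
    (forall A, A \in edges -> k <= size (undup (L A))) ->
    exists c, proper_edge_coloring c /\ forall A, A \in edges -> c A \in L A.

Definition is_chromatic_index (k : nat) : Prop :=
  edge_colorable k /\ forall j, edge_colorable j -> k <= j.

Definition is_list_chromatic_index (k : nat) : Prop :=
  edge_choosable k /\ forall j, edge_choosable j -> k <= j.

End Graphs.

(* Main.v *)
Require Import Defs.
From mathcomp Require Import all_boot.
From mathcomp Require Import zify.
Set Implicit Arguments. Unset Strict Implicit. Unset Printing Implicit Defensive.

(** Let k be the maximum degree, raised to 3 if there is an odd cycle; k is a lower
    bound for the chromatic index, so it suffices to colour from lists of size k.  One
    colours block by block, and the edges of a block at the cut vertex r where it is
    attached have lost colours: their lists are only known to have size deg(r).

    An ear of an odd cycle C turns one of the two arcs of C into the intersection of two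
    odd cycles, so that arc is a single edge.  Hence a block is bipartite, or K4, or
    consists of an edge uv and internally disjoint even u-v paths.  Bipartite blocks are
    coloured by Galvin's kernel method, started from a Koenig colouring using at r exactly
    the first deg(r) colours.  In the third case, colouring uv leaves a bipartite graph of
    maximum degree k - 1 to which the same method applies, except when r is the middle of a
    u-v path of length two, which is handled directly. *)

(** * Rooted list colouring of bipartite graphs *)

(** The bound deg(r) is what gluing delivers: the part coloured earlier uses at a cut vertex v at
    most d1 colours, d1 being its degree at v, and k - d1 is at least the degree of v in the part
    still to be coloured. So each block has only one weak vertex. Galvin's count tolerates one. An
    edge of Koenig colour i is dominated by at most m - 1 - i edges at one end, where m bounds the
    colours occurring there, and by at most i edges at the other; hence m list colours suffice, and
    at r one may take m = deg(r). Removing uv is affordable because k is at least 3: vertices other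
    than u and v have degree at most 2, hence at most k - 1. The obstacle is a root of degree two
    adjacent to both u and v: its two edges may have only two colours each, and both may lose the
    colour of uv, so ur, vr and uv have to be coloured together. *)

Definition fdeg (I : finType) (U : eqType) (f : I -> U) (E : {set I}) (u : U) :=
  #|[set A in E | f A == u]|.

(** A bipartite multigraph is a set of abstract edges with one end map per side, so that sharing an
    end means agreeing under [f] or under [g]. *)
Definition fmeet (I U V : eqType) (f : I -> U) (g : I -> V) (A B : I) :=
  (f A == f B) || (g A == g B).

Definition fproper (I : finType) (U V C : eqType) (f : I -> U) (g : I -> V)
    (E : {set I}) (c : I -> C) :=
  forall A B, A \in E -> B \in E -> A != B -> fmeet f g A B -> c A != c B.

Lemma card_range (I : finType) (S : {set I}) (c : I -> nat) lo hi :
  {in S &, injective c} -> (forall A, A \in S -> lo <= c A < hi) ->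
  #|S| <= hi - lo.
Proof.
move=> cI cS.
have -> : #|S| = size [seq c A | A <- enum S] by rewrite size_map -cardE.
rewrite -(size_iota lo (hi - lo)); apply: uniq_leq_size.
  rewrite map_inj_in_uniq ?enum_uniq // => A B; rewrite !mem_enum; exact: cI.
move=> n /mapP[A]; rewrite mem_enum => /cS cA ->.
rewrite mem_iota; lia.
Qed.

Lemma free_color (I : finType) (S : {set I}) (c : I -> nat) k :
  #|S| < k -> exists2 a, a < k & forall B, B \in S -> c B != a.
Proof.
move=> Sk.
have : ~~ all (fun a => a \in [seq c B | B <- enum S]) (iota 0 k).
  apply/negP => /allP sub.
  have := uniq_leq_size (iota_uniq 0 k) sub.
  by rewrite size_iota size_map -cardE leqNgt Sk.
case/allPn => a; rewrite mem_iota /= => ak nin.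
exists a => // B BS; apply: contraNneq nin => <-.
by apply: map_f; rewrite mem_enum.
Qed.

Lemma fdegD1 (I : finType) (U : eqType) (f : I -> U) (E : {set I}) A u :
  A \in E -> fdeg f E u = (f A == u) + fdeg f (E :\ A) u.
Proof.
move=> AE; rewrite /fdeg; have [fA|fA] := eqVneq (f A) u.
  rewrite (cardsD1 A) inE AE fA eqxx /=; congr (_ + _); apply: eq_card => B.
  by rewrite !inE andbA.
rewrite add0n; apply: eq_card => B; rewrite !inE.
by have [->|] := eqVneq B A; rewrite ?(negbTE fA) ?andbF.
Qed.

(** Induction on the edges, with [a] missing at [f A0] and [b] missing at [g A0]. If an edge [A1] at
    [f A0] has colour [b], the two colours are exchanged along the Kempe chain from [A1]. The chain
    enters [g]-vertices through [b]-edges only, so it never reaches [g A0], and afterwards [b] is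
    free at both ends of [A0]. *)
Lemma koenig (I : finType) (U V : eqType) (f : I -> U) (g : I -> V) k
    (E : {set I}) :
  (forall u, fdeg f E u <= k) -> (forall v, fdeg g E v <= k) ->
  exists c : I -> nat, fproper f g E c /\ forall A, A \in E -> c A < k.
Proof.
move En: #|E| => n; elim: n E En => [|n IH] E En dU dV.
  exists (fun=> 0); have E0 := cards0_eq En.
  by split=> [A B|A]; rewrite E0 inE.
have /card_gt0P[A0 A0E] : 0 < #|E| by rewrite En.
have En' : #|E :\ A0| = n by move: En; rewrite (cardsD1 A0) A0E => -[].
have [u|v|c [cP ck]] := IH _ En'.
- by have := dU u; rewrite (fdegD1 _ u A0E); lia.
- by have := dV v; rewrite (fdegD1 _ v A0E); lia.
have [a ak aP] : exists2 a, a < k &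
    forall B, B \in [set B in E :\ A0 | f B == f A0] -> c B != a.
  apply: free_color; have := dU (f A0).
  by rewrite (fdegD1 _ _ A0E) eqxx.
have [b bk bP] : exists2 b, b < k &
    forall B, B \in [set B in E :\ A0 | g B == g A0] -> c B != b.
  apply: free_color; have := dV (g A0).
  by rewrite (fdegD1 _ _ A0E) eqxx.
have {}aP B : B \in E :\ A0 -> f B = f A0 -> c B <> a.
  by move=> BE fB; apply/eqP/aP; rewrite inE BE fB eqxx.
have {}bP B : B \in E :\ A0 -> g B = g A0 -> c B <> b.
  by move=> BE fB; apply/eqP/bP; rewrite inE BE fB eqxx.
suff [c' [c'P c'k c'b]] : exists c' : I -> nat,
    [/\ fproper f g (E :\ A0) c', forall A, A \in E :\ A0 -> c' A < k &
        forall B, B \in E :\ A0 -> fmeet f g A0 B -> c' B != b].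
  exists (fun A => if A == A0 then b else c' A); split; last first.
    by move=> A AE; case: eqP => // /eqP nA; apply: c'k; rewrite !inE nA.
  have mC A B : fmeet f g A B = fmeet f g B A.
    by rewrite /fmeet eq_sym [g A == _]eq_sym.
  move=> A B AE BE nAB; case: (eqVneq A A0) => [eA|nA]; case: (eqVneq B A0) => [eB|nB].
  - by rewrite eA eB eqxx in nAB.
  - by rewrite eA eq_sym => ?; apply: c'b; rewrite // !inE nB.
  - by rewrite eB mC => ?; apply: c'b; rewrite // !inE nA.
  - by apply: c'P; rewrite // !inE ?nA ?nB.
case: (pickP [pred B in E :\ A0 | (f B == f A0) && (c B == b)]) => [A1|noA1]; last first.
  exists c; split=> // B BE /orP[]/eqP eB; apply/eqP.
    by move: (noA1 B); rewrite !inE in BE *; rewrite BE eB eqxx /= => /eqP.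
  by apply: bP.
rewrite !inE => /andP[/andP[nA1 A1E] /andP[/eqP fA1 /eqP cA1]].
have {nA1} {}A1E : A1 \in E :\ A0 by rewrite !inE nA1.
have ab : a <> b by move=> ab; apply: (aP A1); rewrite // ab.
(* The Kempe chain starting at [A1]; oriented away from the vertex [f A0]. *)
pose r P Q := (Q \in E :\ A0) &&
  [|| [&& c P == b, c Q == a & g P == g Q] | [&& c P == a, c Q == b & f P == f Q]].
pose S := [set Q | connect r A1 Q].
have SA1 : A1 \in S by rewrite inE connect0.
have Sr P Q : P \in S -> r P Q -> Q \in S.
  by rewrite !inE => AP PQ; apply: connect_trans AP (connect1 PQ).
have pred Q : Q \in S -> Q = A1 \/ exists2 P, P \in S & r P Q.
  rewrite inE => /connectP[p]; case/lastP: p => [|p z]; first by move=> _ ->; left.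
  rewrite rcons_path last_rcons => /andP[pp rz] ->; right.
  by exists (last A1 p) => //; rewrite inE; apply/connectP; exists p.
have SE Q : Q \in S -> Q \in E :\ A0.
  by case/pred => [-> //|[P _ /andP[]]].
have Sab Q : Q \in S -> c Q = a \/ c Q = b.
  case/pred => [->|[P _ /andP[_ /orP[]/and3P[_ /eqP ? _]]]]; tauto.
have same A B : A \in E :\ A0 -> B \in E :\ A0 -> c A = c B -> fmeet f g A B -> A = B.
  by move=> AE BE cAB m; apply/eqP/contraT => /cP/(_ m); rewrite cAB eqxx => /(_ AE BE).
have preda Q : Q \in S -> c Q = a ->
    exists P, [/\ P \in S, c P = b & g P = g Q].
  move=> QS cQ; case: (pred _ QS) => [eQ|[P PS]]; first by rewrite -cQ eQ in ab.
  rewrite /r cQ => /andP[_ /orP[]/and3P[/eqP ? /eqP ? /eqP ?]]; last by case: ab.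
  by exists P.
have predb Q : Q \in S -> c Q = b ->
    Q = A1 \/ exists P, [/\ P \in S, c P = a & f P = f Q].
  move=> QS cQ; case: (pred _ QS) => [->|[P PS]]; first by left.
  rewrite /r cQ => /andP[_ /orP[]/and3P[/eqP ? /eqP ? /eqP ?]]; first by case: ab.
  by right; exists P.
(* Although [r] is directed, the chain is a whole component of the two-colour subgraph: a neighbour
   met against the orientation equals the predecessor by properness, and [A1] has no other neighbour
   at [f A0] because [a] is missing there. *)
have clos A B : A \in S -> B \in E :\ A0 -> A != B -> fmeet f g A B ->
    c B = a \/ c B = b -> B \in S.
  move=> AS BE nAB m cB; have AE := SE _ AS; have := cP _ _ AE BE nAB m.
  case: (Sab _ AS) cB => cA [] cB; rewrite cA cB ?eqxx // => _.
  - have [fAB|fAB] := eqVneq (f A) (f B).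
      by apply: Sr AS _; rewrite /r BE cA cB fAB !eqxx orbT.
    have gAB : g A = g B by apply/eqP; move: m; rewrite /fmeet (negbTE fAB).
    have [P [PS Pc Pg]] := preda _ AS cA.
    suff -> : B = P by [].
    by apply: same => //; [exact: SE | rewrite Pc | rewrite /fmeet Pg gAB eqxx orbT].
  - have [fAB|fAB] := eqVneq (f A) (f B); last first.
      by apply: Sr AS _; move: m; rewrite /fmeet (negbTE fAB) /r BE cA cB !eqxx /= => ->.
    case: (predb _ AS cA) => [eA|[P [PS Pc Pg]]].
      by case: (aP B); rewrite // -fAB eA.
    suff -> : B = P by [].
    by apply: same => //; [exact: SE | rewrite Pc | rewrite /fmeet Pg fAB eqxx].
pose c' Q := if Q \in S then (if c Q == a then b else a) else c Q.
exists c'; split.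
- have half A B : A \in S -> B \in E :\ A0 -> A != B -> fmeet f g A B -> c' A != c' B.
    move=> AS BE nAB m; rewrite /c' AS; have := cP _ _ (SE _ AS) BE nAB m.
    have := clos _ _ AS BE nAB m; have := Sab _ AS; have := Sab B.
    case: (B \in S) => [/(_ isT) SB|_] SA cl nc.
      by have [?|?] := eqVneq (c A) a; have [?|?] := eqVneq (c B) a; lia.
    have cB : ~ (c B = a \/ c B = b) by move/cl.
    by have [?|?] := eqVneq (c A) a; lia.
  move=> A B AE BE nAB m.
  have [AS|AS] := boolP (A \in S); first exact: half.
  have [BS|BS] := boolP (B \in S).
    rewrite eq_sym; apply: half; rewrite // 1?eq_sym //.
    by rewrite /fmeet eq_sym [g B == _]eq_sym.
  by rewrite /c' (negbTE AS) (negbTE BS); apply: cP.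
- by move=> A AE; rewrite /c'; case: (A \in S); [case: (c A == a) | apply: ck].
- move=> B BE; rewrite /fmeet /c'.
  have [BS /orP[]/eqP eB|BS /orP[]/eqP eB] := boolP (B \in S).
  + have [cB|cB] := eqVneq (c B) a; last by apply/eqP; move=> e; case: ab.
    by case: (aP B BE (esym eB)).  
  + have [cB|cB] := eqVneq (c B) a; last by apply/eqP; move=> e; case: ab.
    have [P [PS Pc Pg]] := preda _ BS cB.
    by case: (bP P (SE _ PS)); rewrite ?Pg.
  + apply: contraNneq BS => cB.
    suff -> : B = A1 by [].
    by apply: same; rewrite ?cA1 // /fmeet -eB fA1 eqxx.
  + by apply/eqP/bP.
Qed.

Definition beats (I U V : eqType) (f : I -> U) (g : I -> V) (c : I -> nat) B A :=
  (f A == f B) && (c A < c B) || (g A == g B) && (c B < c A).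

(* Stable matchings: [f]-vertices prefer large colours and [g]-vertices small ones. *)
Lemma kernel_exists (I : finType) (U V : eqType) (f : I -> U) (g : I -> V)
    (c : I -> nat) (E : {set I}) :
  fproper f g E c ->
  exists K : {set I}, [/\ K \subset E,
    forall A B, A \in K -> B \in K -> A != B -> ~~ fmeet f g A B &
    forall A, A \in E -> A \notin K -> exists2 B, B \in K & beats f g c B A].
Proof.
move En: #|E| => n; elim: n E En => [|n IH] E En cP.
  by exists set0; rewrite (cards0_eq En); split=> [|A B|A]; rewrite ?inE ?sub0set.
(* Gale-Shapley proposals: every [f]-vertex proposes its edge of largest colour. If a proposal [A]
   meets an edge [B] of larger colour at a [g]-vertex, [B] may be deleted: a kernel of the rest
   contains [A] or dominates it at that [g]-vertex, and so dominates [B] as well. *)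
pose K0 := [set A in E | [forall B in E, (f B == f A) ==> (c B <= c A)]].
have K0P A B : A \in K0 -> B \in E -> f B = f A -> c B <= c A.
  by rewrite inE => /andP[_ /forall_inP h] /h /implyP h' fAB; apply: h'; rewrite fAB.
have K0E A : A \in K0 -> A \in E by rewrite inE => /andP[].
case: (boolP [forall A in K0, [forall B in K0, (A != B) ==> ~~ fmeet f g A B]]).
  move=> H; exists K0; split.
  - by apply/subsetP.
  - by move=> A B AK BK nAB; move/forall_inP: H => /(_ A AK)/forall_inP/(_ B BK)/implyP; apply.
  - move=> A AE AK.
    have PA : (A \in E) && (f A == f A) by rewrite AE eqxx.
    case: (@arg_maxnP _ A (fun B => (B \in E) && (f B == f A)) c PA)
      => B /andP[BE /eqP fB] Bmax.
    exists B.
      rewrite inE BE /=; apply/forall_inP => C CE; apply/implyP => /eqP fC.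
      by apply: Bmax; rewrite CE fC fB eqxx.
    rewrite /beats fB eqxx /=; move: AK; rewrite inE AE /=.
    case/forall_inPn => C CE; rewrite negb_imply => /andP[fC]; rewrite -ltnNge => AC.
    by rewrite (leq_trans AC) //; apply: Bmax; rewrite CE fC.
case/forall_inPn => A AK /forall_inPn[B BK]; rewrite negb_imply negbK => /andP[nAB m].
suff: 
    exists A B, [/\ A \in K0, B \in E, A != B, g A = g B & c A < c B].
  move=> {A B AK BK nAB m} [A [B [AK BE nAB gAB cAB]]].
  have En' : #|E :\ B| = n by move: En; rewrite (cardsD1 B) BE => -[].
  have [|K [KE Kind Kabs]] := IH _ En'.
    by move=> C D; rewrite !inE => /andP[_ CE] /andP[_ DE]; apply: cP.
  exists K; split=> //; first exact: subset_trans KE (subsetDl _ _).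
  move=> C CE CK; have [eC|nC] := eqVneq C B; last by apply: Kabs; rewrite // !inE nC.
  rewrite {}eC in CE CK *.
  have [AinK|AK'] := boolP (A \in K).
    by exists A => //; rewrite /beats gAB eqxx cAB orbT.
  have [|D DK /orP[]/andP[/eqP e1 l1]] := Kabs A _ AK'; first by rewrite !inE nAB K0E.
    have DE : D \in E by have := subsetP KE D DK; rewrite !inE => /andP[].
    by have := K0P _ _ AK DE (esym e1); rewrite leqNgt l1.
  by exists D => //; rewrite /beats -gAB e1 eqxx (ltn_trans l1 cAB) orbT.
have nc := cP _ _ (K0E _ AK) (K0E _ BK) nAB m.
have [fAB|fAB] := eqVneq (f A) (f B).
  have := K0P _ _ AK (K0E _ BK) (esym fAB); have := K0P _ _ BK (K0E _ AK) fAB; lia.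
have gAB : g A = g B by apply/eqP; move: m; rewrite /fmeet (negbTE fAB).
case: (ltngtP (c A) (c B)) nc => // cAB _.
  by exists A, B; split => //; apply: K0E.
by exists B, A; split => //; [apply: K0E | rewrite eq_sym].
Qed.

(** The kernel of the edges whose lists contain [q] receives colour [q]. Every other edge that loses
    [q] from its list also loses a dominating edge, so the strict inequality survives the induction.
    The default [q0] provides a colouring of the empty edge set. *)
Lemma galvin_beats (I Q : finType) (U V : eqType) (f : I -> U) (g : I -> V)
    (c : I -> nat) (q0 : Q) (E : {set I}) (L : I -> {set Q}) :
  fproper f g E c ->
  (forall A, A \in E -> #|[set B in E | beats f g c B A]| < #|L A|) ->
  exists phi : I -> Q, fproper f g E phi /\ forall A, A \in E -> phi A \in L A.
Proof.
move En: #|E| => n; elim/ltn_ind: n E En L => n IH E En L cP LP.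
have [E0|/set0Pn[A0 A0E]] := eqVneq E set0.
  by exists (fun=> q0); rewrite E0; split=> [A B|A]; rewrite inE.
have /card_gt0P[q qA0] : 0 < #|L A0| by apply: leq_trans (LP _ A0E).
have [|K [KE Kind Kabs]] := @kernel_exists _ _ _ f g c [set A in E | q \in L A].
  by move=> A B; rewrite !inE => /andP[? _] /andP[? _]; apply: cP.
have KE' A : A \in K -> A \in E /\ q \in L A.
  by move/(subsetP KE); rewrite inE => /andP.
have /card_gt0P[B0 B0K] : 0 < #|K|.
  rewrite lt0n; apply/negP => /eqP/cards0_eq K0.
  by have [||B] := Kabs A0; rewrite ?inE ?A0E ?K0 // inE.
have lt : #|E :\: K| < n.
  rewrite -En; apply: proper_card; apply/properP; split; first exact: subsetDl.
  by exists B0; [have [] := KE' _ B0K | rewrite inE B0K].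
have [||phi [pP pL]] := IH _ lt (E :\: K) erefl (fun A => L A :\ q).
- by move=> A B; rewrite !inE => /andP[_ ?] /andP[_ ?]; apply: cP.
- move=> A; rewrite inE => /andP[AK AE]; have := LP _ AE.
  rewrite (cardsD1 q (L A)); case qA: (q \in L A); last first.
    rewrite add0n; apply: leq_ltn_trans; apply: subset_leq_card; apply/subsetP => B.
    by rewrite !inE => /andP[/andP[_ ->] ->].
  have [||B BK bBA] := Kabs A; rewrite ?inE ?AE //.
  rewrite add1n ltnS; apply: leq_trans; apply: proper_card; apply/properP; split.
    by apply/subsetP => C; rewrite !inE => /andP[/andP[_ ->] ->].
  by exists B; rewrite !inE ?BK ?bBA // !andbT; case: (KE' _ BK).
have pq A : A \in E -> A \notin K -> phi A != q /\ phi A \in L A.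
  by move=> AE AK; have := pL A; rewrite !inE AK AE => /(_ isT) /andP.
exists (fun A => if A \in K then q else phi A); split.
  move=> A B AE BE nAB m.
  have [AK|AK] := boolP (A \in K); have [BK|BK] := boolP (B \in K).
  - by have := Kind _ _ AK BK nAB; rewrite m.
  - by rewrite eq_sym; case: (pq B BE BK).
  - by case: (pq A AE AK).
  - by apply: pP; rewrite // inE ?AK ?BK.
move=> A AE; have [/KE'[]//|AK] := boolP (A \in K).
by case: (pq A AE AK).
Qed.

(* Galvin's argument with a distinguished vertex [r]: the colours of a Koenig
   colouring are permuted so that those occurring at [r] come first. *)
Lemma galvin_rooted (I Q : finType) (U V : eqType) (f : I -> U) (g : I -> V)
    (q0 : Q) (E : {set I}) (L : I -> {set Q}) k (r : U) :
  (forall u, fdeg f E u <= k) -> (forall v, fdeg g E v <= k) ->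
  (forall A, A \in E -> (if f A == r then fdeg f E r else k) <= #|L A|) ->
  exists phi : I -> Q, fproper f g E phi /\ forall A, A \in E -> phi A \in L A.
Proof.
move=> dU dV LP; have [c [cP ck]] := koenig dU dV.
pose s1 := [seq c A | A <- enum [set A in E | f A == r]].
pose s := s1 ++ [seq i <- iota 0 k | i \notin s1].
have mem_s A : A \in E -> c A \in s.
  move=> AE; rewrite mem_cat mem_filter mem_iota /= ck // andbT.
  by case: (c A \in s1).
have size_s1 : size s1 = fdeg f E r by rewrite size_map -cardE.
have us1 : uniq s1.
  rewrite map_inj_in_uniq ?enum_uniq // => A B; rewrite !mem_enum !inE.
  move=> /andP[AE /eqP fA] /andP[BE /eqP fB] cAB; apply/eqP/contraT => nAB.
  by have := cP A B AE BE nAB; rewrite /fmeet fA fB eqxx cAB eqxx => /(_ isT).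
have size_s : size s <= k.
  rewrite -(size_iota 0 k); apply: uniq_leq_size.
    rewrite cat_uniq us1 filter_uniq ?iota_uniq // andbT /=.
    by apply/hasPn => i; rewrite mem_filter => /andP[].
  move=> i; rewrite mem_cat mem_filter => /orP[/mapP[A]|/andP[]//].
  by rewrite mem_enum inE => /andP[AE _] ->; rewrite mem_iota /= ck.
pose c' A := index (c A) s.
have c'I A B : A \in E -> B \in E -> c' A = c' B -> c A = c B.
  move=> AE BE e; rewrite -[c A](nth_index 0 (mem_s _ AE)) -[c B](nth_index 0 (mem_s _ BE)).
  by rewrite -/(c' A) -/(c' B) e.
have c'P : fproper f g E c'.
  move=> A B AE BE nAB m; apply: contra (cP _ _ AE BE nAB m) => /eqP e.
  by apply/eqP; apply: c'I.
apply: (galvin_beats q0 c'P) => A AE; apply: leq_trans (LP _ AE).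
have Ak : c' A < (if f A == r then fdeg f E r else k) /\
    forall B, B \in E -> f A = f B -> c' B < (if f A == r then fdeg f E r else k).
  suff H B : B \in E -> c' B < (if f B == r then fdeg f E r else k).
    by split=> [|B BE ->]; apply: H.
  move=> BE; case: eqP => fB; last by apply: leq_trans size_s; rewrite index_mem mem_s.
  have cB : c B \in s1 by apply: map_f; rewrite mem_enum inE BE fB eqxx.
  by rewrite /c' index_cat cB -size_s1 index_mem.
case: Ak => Ak Bk; set m := (if _ then _ else _) in Ak Bk *.
have injS (S : {set I}) : S \subset E ->
    (forall B C, B \in S -> C \in S -> fmeet f g B C) -> {in S &, injective c'}.
  move=> /subsetP SE Sm B C BS CS e; apply/eqP/contraT => nBC.
  by have := c'P _ _ (SE _ BS) (SE _ CS) nBC (Sm _ _ BS CS); rewrite e eqxx.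
(* All colours at [f A] are below [m], so at most [m - 1 - c' A] edges dominate [A] there, and at
   most [c' A] do so at [g A]: altogether fewer than [m]. *)
pose S1 := [set B in E | (f A == f B) && (c' A < c' B)].
pose S2 := [set B in E | (g A == g B) && (c' B < c' A)].
have S1c : #|S1| <= m - (c' A).+1.
  apply: (@card_range _ _ c').
    apply: injS => [|B C]; first by apply/subsetP => B; rewrite inE => /andP[].
    by rewrite !inE /fmeet => /and3P[_ /eqP <- _] /and3P[_ /eqP <- _]; rewrite eqxx.
  by move=> B; rewrite inE => /and3P[BE /eqP fB ->]; rewrite Bk.
have S2c : #|S2| <= c' A - 0.
  apply: (@card_range _ _ c').
    apply: injS => [|B C]; first by apply/subsetP => B; rewrite inE => /andP[].
    by rewrite !inE /fmeet => /and3P[_ /eqP <- _] /and3P[_ /eqP <- _]; rewrite eqxx orbT.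
  by move=> B; rewrite inE => /and3P[_ _ ->].
have : #|[set B in E | beats f g c' B A]| <= #|S1| + #|S2|.
  apply: leq_trans (leq_card_setU _ _); apply: subset_leq_card; apply/subsetP => B.
  by rewrite !inE -andb_orr /beats => /andP[-> /=].
lia.
Qed.

(** * Odd cycles in graphs of the class *)

Section CycleEdges.
Variable T : finType.
Implicit Types (p q s : seq T) (x y z : T) (A : {set T}).

Lemma cycle_edges_sub p A x : A \in cycle_edges p -> x \in A -> x \in p.
Proof.
by case/imsetP => z zp ->; rewrite !inE => /orP[]/eqP ->; rewrite ?mem_next.
Qed.

Lemma cycle_edges_rot n p : uniq p -> cycle_edges (rot n p) = cycle_edges p.
Proof.
move=> up; apply/setP => A; apply/imsetP/imsetP => -[x xp ->]; exists x.
- by rewrite -(mem_rot n).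
- by rewrite next_rot.
- by rewrite mem_rot.
- by rewrite next_rot.
Qed.

Lemma cycle_edges_head x y p : [set x; y] \in cycle_edges [:: x, y & p].
Proof. by apply/imsetP; exists x; rewrite ?inE ?eqxx //= eqxx. Qed.

Lemma cycle_edges_mid p1 x y p2 : uniq (p1 ++ [:: x, y & p2]) ->
  [set x; y] \in cycle_edges (p1 ++ [:: x, y & p2]).
Proof.
move=> up; rewrite -(cycle_edges_rot (size p1)) // rot_size_cat.
exact: cycle_edges_head.
Qed.

Lemma cycle_edges_last x p : uniq (x :: p) -> [set last x p; x] \in cycle_edges (x :: p).
Proof.
case/lastP: p => [|p y] up; first by apply/imsetP; exists x; rewrite ?inE //= eqxx.
rewrite last_rcons -(cycle_edges_rot (size p).+1) //.
have -> : rot (size p).+1 (x :: rcons p y) = [:: y, x & p].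
  by rewrite -cats1 -cat_cons (_ : (size p).+1 = size (x :: p)) // rot_size_cat.
exact: cycle_edges_head.
Qed.

Lemma mem_cycle_edgesP p x z : uniq p -> x \in p -> [set x; z] \in cycle_edges p ->
  z = next p x \/ z = prev p x.
Proof.
move=> up xp /imsetP[y yp] /setP E.
have [eyx|nyx] := eqVneq y x.
  have := E z; rewrite eyx !inE eqxx orbT => /esym/orP[]/eqP zE; last by left.
  by have := E (next p x); rewrite eyx zE !inE eqxx orbT orbb => /eqP ->; left.
have := E x; rewrite !inE eqxx [x == y]eq_sym (negbTE nyx) /= => /esym/eqP ->.
rewrite prev_next //; right.
by have := E y; rewrite !inE eqxx (negbTE nyx) /= => /eqP.
Qed.

Lemma next_prev_edges p x : uniq p -> 2 < size p -> x \in p ->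
  [/\ [set x; next p x] \in cycle_edges p, [set x; prev p x] \in cycle_edges p &
      [set x; next p x] != [set x; prev p x]].
Proof.
move=> up sp xp; split.
- by apply/imsetP; exists x.
- by apply/imsetP; exists (prev p x); rewrite ?mem_prev // next_prev // setUC.
case/rot_to: (xp) => i q Eq; rewrite -(next_rot i) // -(prev_rot i) // Eq.
have uq : uniq (x :: q) by rewrite -Eq rot_uniq.
have: 2 < size (x :: q) by rewrite -Eq size_rot.
move En: (next _ x) => n; move Em: (prev _ x) => m.
case: q uq {Eq} En Em => [|y q] //; case/lastP: q => [|q z] //.
move=> uq En Em _; have := uq; rewrite /= !(inE, mem_rcons) !negb_or.
case/and3P => /and3P[xy xz xq] /andP[yz yq] _.
have <- : y = n by rewrite -En /= eqxx.
have <- : z = m.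
  rewrite -Em prev_nth mem_head memNindex; last by rewrite !(inE, mem_rcons) !negb_or xy xz.
  by rewrite -[X in nth _ _ X]/((size [:: x, y & rcons q z]).-1) nth_last /= last_rcons.
apply/eqP => /setP/(_ y); rewrite !inE eqxx orbT [y == x]eq_sym (negbTE xy) /=.
by rewrite (negbTE yz).
Qed.

End CycleEdges.

Section OddCycles.
Variables (T : finType) (e : rel T).
Hypotheses (e_sym : symmetric e) (e_irr : irreflexive e).
Implicit Types (p q s : seq T) (x y z : T) (A : {set T}).

Lemma odd_cycle_rot n p : odd_cycle e (rot n p) = odd_cycle e p.
Proof. by rewrite /odd_cycle /is_cycle /ucycleb rot_cycle rot_uniq size_rot. Qed.

Lemma odd_cycle_uniq p : odd_cycle e p -> uniq p.
Proof. by case/andP => /andP[/andP[]]. Qed.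

(** The normal form for a cycle cut into two arcs. The length condition is absorbed, since an odd
    [size p1 + size p2] already gives a third vertex. *)
Lemma odd_cycle_split x p1 y p2 : odd_cycle e (x :: p1 ++ y :: p2) =
  [&& path e x (rcons p1 y), path e y (rcons p2 x), uniq (x :: p1 ++ y :: p2) &
      odd (size p1 + size p2)].
Proof.
rewrite /odd_cycle /is_cycle /ucycleb /cycle rcons_cat rcons_cons cat_path.
rewrite rcons_path /= size_cat /= addnS /= negbK.
case: (path e x p1); case: (e (last x p1) y); rewrite ?andbF //=.
case: (path e y _); rewrite ?andbF //=.
by rewrite -andbA; congr (_ && _); case: (size p1 + size p2).
Qed.

Lemma path_rev x s y : path e x (rcons s y) = path e y (rcons (rev s) x).
Proof.
have := rev_path e x (rcons s y); rewrite last_rcons belast_rcons rev_cons => ->.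
by apply: eq_path => a b; rewrite e_sym.
Qed.

Hypothesis Gs : in_Gstar e.

Lemma Gstar_eq p q A B : odd_cycle e p -> odd_cycle e q -> A != B ->
  A \in cycle_edges p -> B \in cycle_edges p ->
  A \in cycle_edges q -> B \in cycle_edges q -> cycle_edges p = cycle_edges q.
Proof.
move=> op oq nAB Ap Bp Aq Bq; apply/eqP/contraT => /(Gs op oq).
have sub : [set A; B] \subset cycle_edges p :&: cycle_edges q.
  by apply/subsetP => C; rewrite !inE => /orP[]/eqP ->; apply/andP.
by move/(leq_trans (subset_leq_card sub)); rewrite cards2 nAB.
Qed.

(** The ear and the arc [p2] form an odd cycle. If [p2] had an inner vertex, its first and last
    edges would be two common edges of this cycle and the old one, forcing equal edge sets; but a
    vertex of [s], or of [p1] when [s] is empty, lies on only one of them. *)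
Lemma odd_ear_aux x p1 y p2 s : odd_cycle e (x :: p1 ++ y :: p2) ->
  path e x (rcons s y) -> uniq s -> (forall z, z \in s -> z \notin x :: p1 ++ y :: p2) ->
  s <> [::] \/ p1 <> [::] ->
  odd (size s + size p2) -> p2 = [::].
Proof.
move=> oC sP us sC ne od.
have := oC; rewrite odd_cycle_split => /and4P[P1 P2 uC odC].
have uq : uniq (x :: s ++ y :: p2).
  rewrite -cat_cons cat_uniq cons_uniq us.
  have -> : x \notin s by apply/negP => /sC; rewrite inE eqxx.
  move: uC; rewrite -cat_cons cat_uniq => /and3P[_ H ->]; rewrite !andbT !andTb.
  apply/hasPn => z zy; rewrite inE negb_or.
  move/hasPn/(_ z zy): H; rewrite /= inE negb_or => /andP[-> _] /=.
  by apply/negP => /sC; rewrite inE mem_cat zy !orbT.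
have oq : odd_cycle e (x :: s ++ y :: p2) by rewrite odd_cycle_split sP P2 uq.
case: p2 od => // b p2 od in oC sC P2 uC odC uq oq *.
have last_eq s0 : last x (s0 ++ [:: y, b & p2]) = last b p2 by rewrite last_cat.
have yl : y \notin x :: b :: p2.
  move: uC; rewrite /= cat_uniq mem_cat /= !inE !negb_or.
  case/andP => /and4P[_ xy _ _] /and5P[_ _ yp _ _].
  by rewrite eq_sym xy.
have nAB : [set y; b] != [set last b p2; x].
  apply/eqP => /setP/(_ y); rewrite !inE eqxx /=.
  move: yl; rewrite in_cons negb_or => /andP[/negbTE -> yl].
  by rewrite orbF; case: eqP => // E; rewrite E mem_last in yl.
have E : cycle_edges (x :: p1 ++ [:: y, b & p2]) = cycle_edges (x :: s ++ [:: y, b & p2]).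
  apply: Gstar_eq oC oq nAB _ _ _ _.
  - by rewrite -cat_cons; apply: cycle_edges_mid; rewrite cat_cons.
  - by rewrite -(last_eq p1); apply: cycle_edges_last.
  - by rewrite -cat_cons; apply: cycle_edges_mid; rewrite cat_cons.
  - by rewrite -(last_eq s); apply: cycle_edges_last.
case: s => [|z s] in sC ne sP us od E uq oq last_eq *.
  case: ne => // ne; case: p1 => // a p1 in ne oC sC P1 uC odC E *.
  have /cycle_edges_sub/(_ (set22 _ _)) :
      [set x; a] \in cycle_edges (x :: [::] ++ [:: y, b & p2]).
    by rewrite -E; apply: cycle_edges_head.
  move: uC; rewrite /= !inE !mem_cat !inE !negb_or eq_sym.
  by case/and3P => /andP[xa _] /and4P[_ ay ab ap] _; rewrite (negbTE xa) (negbTE ay) (negbTE ab) (negbTE ap).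
have /cycle_edges_sub/(_ (set22 _ _)) zC :
    [set x; z] \in cycle_edges (x :: p1 ++ [:: y, b & p2]).
  by rewrite E; apply: cycle_edges_head.
by have := sC z; rewrite inE eqxx zC => /(_ isT).
Qed.

(* An ear of an odd cycle [C] (including a chord, [s = [::]]) makes one of the two
   arcs of [C] the common part of two odd cycles. *)
Lemma odd_ear x p1 y p2 s : odd_cycle e (x :: p1 ++ y :: p2) ->
  path e x (rcons s y) -> uniq s -> (forall z, z \in s -> z \notin x :: p1 ++ y :: p2) ->
  s <> [::] \/ (p1 <> [::] /\ p2 <> [::]) ->
  odd (size s) /\ (p1 = [::] \/ p2 = [::]).
Proof.
move=> oC sP us sC ne.
have := oC; rewrite odd_cycle_split => /and4P[_ _ _ odC].
(* The two arcs have opposite parities, so the ear closes an odd cycle with exactly one of them.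
   That arc has no inner vertex, which fixes the parity of the ear. *)
have [od|od] := boolP (odd (size s + size p2)).
  have p20 : p2 = [::] by apply: (odd_ear_aux oC sP us sC _ od); tauto.
  by split; [rewrite p20 addn0 in od | right].
have Er : y :: p2 ++ x :: p1 = rot (size p1).+1 (x :: p1 ++ y :: p2).
  by rewrite -cat_cons (_ : (size p1).+1 = size (x :: p1)) // rot_size_cat.
have p10 : p1 = [::].
  apply: (@odd_ear_aux y p2 x p1 (rev s)).
  - by rewrite Er odd_cycle_rot.
  - by rewrite -path_rev.
  - by rewrite rev_uniq.
  - by move=> z; rewrite mem_rev Er mem_rot; apply: sC.
  - case: ne => [ns|[_ n2]]; [left|by right].
    by move/(congr1 rev); rewrite revK.
  - by rewrite size_rev; lia.
by split; [rewrite p10 in odC *; move: od odC => /=; lia | left].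
Qed.

(** A chord is an ear without inner vertices between two nonempty arcs, which [odd_ear] excludes. *)
Lemma odd_cycle_chordless C w z : odd_cycle e C -> w \in C -> z \in C -> e w z ->
  [set w; z] \in cycle_edges C.
Proof.
move=> oC wC zC ewz; case: (rot_to wC) => i q Eq.
have uC := odd_cycle_uniq oC.
rewrite -(cycle_edges_rot i) // Eq.
have oR : odd_cycle e (w :: q) by rewrite -Eq odd_cycle_rot.
have : z \in w :: q by rewrite -Eq mem_rot.
rewrite inE => /orP[/eqP zw|]; first by rewrite zw e_irr in ewz.
move=> zq; move: Eq oR; case/splitPr: zq => q1 q2 Eq oR; have uR := odd_cycle_uniq oR.
have [q10|nq1] := eqVneq q1 [::]; first by rewrite q10; apply: cycle_edges_head.
have [q20|nq2] := eqVneq q2 [::].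
  by rewrite q20 in uR *; have := cycle_edges_last uR; rewrite last_cat /= setUC.
have [||||_ [q0|q0]] := odd_ear oR (s := [::]) => //=.
- by rewrite ewz.
- by right; split; apply/eqP.
- by rewrite q0 in nq1.
- by rewrite q0 in nq2.
Qed.

End OddCycles.

(** * Nonseparable graphs: ears, and the case of K4 *)

Definition complete4 (T : finType) (e : rel T) (a b c d : T) :=
  [&& e a b, e a c, e a d, e b c, e b d & e c d].

Lemma crossing (T : finType) (r : rel T) (S : pred T) x y :
  connect r x y -> ~~ S x -> S y -> exists a b, [/\ ~~ S a, S b & r a b].
Proof.
case/connectP => p; elim: p x => [|b p IH] x /=; first by move=> _ -> /negP.
case/andP => rxb pp ylast nx Sy; have [Sb|nb] := boolP (S b); first by exists x, b.
exact: IH pp ylast nb Sy.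
Qed.

Lemma first_in (T : eqType) (S : pred T) (p : seq T) : has S p ->
  exists p1 b p2, [/\ p = p1 ++ b :: p2, S b & forall z, z \in p1 -> ~~ S z].
Proof.
elim: p => //= a p IH; have [Sa _|nSa /= /IH] := boolP (S a).
  by exists [::], a, p.
case=> p1 [b [p2 [-> Sb H]]]; exists (a :: p1), b, p2; split=> // z.
by rewrite inE => /predU1P[->|/H].
Qed.

Lemma uniq_count_le1 (T : eqType) (s : seq T) a : uniq s -> count_mem a s <= 1.
Proof. by move=> us; rewrite count_uniq_mem // leq_b1. Qed.

(** Disjointness of paths is tracked by multiplicities: after cutting, reversing and rearranging
    segments, repetition-freeness becomes linear arithmetic. *)
Lemma count_le1_uniq (T : eqType) (s : seq T) : (forall a, count_mem a s <= 1) -> uniq s.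
Proof.
elim: s => //= b s IH H; rewrite IH ?andbT.
  by have := H b; rewrite eqxx add1n ltnS leqn0 => /eqP/count_memPn.
by move=> a; apply: leq_trans (H a); rewrite leq_addl.
Qed.

Section Nonseparable.
Variables (T : finType) (e : rel T).
Hypotheses (e_sym : symmetric e) (e_irr : irreflexive e).
Implicit Types (p q s : seq T) (x y z : T) (A : {set T}).

(** Only vertices carrying an edge must stay connected when [v] is deleted: blocks are edge sets
    over one fixed vertex type, so isolated vertices are harmless. *)
Definition nonseparable := forall v x y x' y', x != v -> y != v -> e x x' -> e y y' ->
  connect (fun a b => [&& a != v, b != v & e a b]) x y.

Hypothesis Gs : in_Gstar e.
Hypothesis ns : nonseparable.

(** Deleting [w] leaves [z] connected to [y]. A simple path between them, cut at its first vertex in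
    [S] and preceded by the edge [wz], is an ear; its ends differ because the path avoids [w]. *)
Lemma ear_exists (S : pred T) w z y y' : S w -> ~~ S z -> e w z -> S y -> y != w -> e y y' ->
  exists w' s, [/\ S w' && (w' != w), path e w (z :: rcons s w'), uniq (z :: s) &
                  forall t, t \in z :: s -> ~~ S t].
Proof.
move=> Sw Sz ewz Sy yw eyy'.
have zw : z != w by apply: contraNneq Sz => ->.
have ezw : e z w by rewrite e_sym.
case/connectP: (ns zw yw ezw eyy') => p0 pp0 yl0.
case: (shortenP pp0) yl0 => p pp up _ yl.
have hp : has S p.
  case/lastP: p yl {pp up} => [|p b /= yl]; first by move=> /= yz; rewrite yz (negbTE Sz) in Sy.
  by rewrite has_rcons -(last_rcons z p b) -yl Sy.
case: (first_in hp) => s [w' [p2 [Ep Sw' H]]].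
rewrite {}Ep in pp up.
exists w', s.
move: pp; rewrite -cat_rcons cat_path => /andP[pp _].
split.
- rewrite Sw' /=; move: pp; rewrite rcons_path => /andP[_ /and3P[]//].
- by rewrite /= ewz /=; apply: sub_path pp => a b /and3P[].
- by move: up; rewrite -cat_cons cat_uniq => /and3P[].
- by move=> t; rewrite inE => /predU1P[->|/H].
Qed.

(** A vertex outside K4 yields an ear from [w] to [w']. It is an ear of the triangle [w w' g], and
    prolonged through [w'] it is an ear of the triangle [w g h]. Both would have an odd number of
    inner vertices, yet these numbers differ by one. *)
Lemma complete4_spanning a b c d x z : complete4 e a b c d -> e x z -> x \in [:: a; b; c; d].
Proof.
move=> K exz; apply: contraT => nx.
have neq u v : e u v -> u != v by apply: contraTneq => ->; rewrite e_irr.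
have ab : a != b by case/and5P: K => /neq.
have xb : x != b by move: nx; rewrite !inE !negb_or => /and4P[].
have eab : e a b by case/andP: K.
have [z0 [w [nz0 Sw /and3P[_ _ ez0w]]]] :=
  crossing (S := mem [:: a; b; c; d]) (ns xb ab exz eab) nx (mem_head _ _).
have [y Sy [yw [y' ey]]] : exists2 y, y \in [:: a; b; c; d] & y != w /\ exists y', e y y'.
  have [wa|wa] := eqVneq w a.
    exists b; first by rewrite !inE eqxx !orbT.
    by rewrite wa eq_sym; split=> //; exists a; rewrite e_sym.
  by exists a; rewrite ?inE ?eqxx // eq_sym; split=> //; exists b.
rewrite e_sym in ez0w.
case: (ear_exists (S := mem [:: a; b; c; d]) Sw nz0 ez0w Sy yw ey) => w' [s [/andP[Sw' w'w] ps us ds]].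
have [g [h [Sg Sh K']]] : exists g h, [/\ g \in [:: a; b; c; d], h \in [:: a; b; c; d] & complete4 e w w' g h].
  have pick g h : g \in [:: a; b; c; d] -> h \in [:: a; b; c; d] -> complete4 e w w' g h ->
     exists g h, [/\ g \in [:: a; b; c; d], h \in [:: a; b; c; d] & complete4 e w w' g h].
    by move=> *; exists g, h.
  case/and5P: K => e1 e2 e3 e4 /andP[e5 e6].
  have e1' := e1; have e2' := e2; have e3' := e3; have e4' := e4; have e5' := e5; have e6' := e6.
  rewrite e_sym in e1'; rewrite e_sym in e2'; rewrite e_sym in e3'.
  rewrite e_sym in e4'; rewrite e_sym in e5'; rewrite e_sym in e6'.
  move: Sw Sw' w'w pick; rewrite /= !inE => /or4P[]/eqP -> /or4P[]/eqP ->;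
    rewrite ?eqxx // => _ pick;
  [ apply: (pick c d) | apply: (pick b d) | apply: (pick b c)
  | apply: (pick c d) | apply: (pick a d) | apply: (pick a c)
  | apply: (pick b d) | apply: (pick a d) | apply: (pick a b)
  | apply: (pick b c) | apply: (pick a c) | apply: (pick a b)];
  by rewrite /complete4 ?inE ?eqxx ?orbT // ?e1 ?e2 ?e3 ?e4 ?e5 ?e6 ?e1' ?e2' ?e3' ?e4' ?e5' ?e6'.
case/and5P: K' => eww' ewg ewh ew'g /andP[ew'h egh].
have ge := neq _ _ ew'g; have wg := neq _ _ ewg; have wh := neq _ _ ewh; have gh := neq _ _ egh.
have w'h := neq _ _ ew'h; have ww' := neq _ _ eww'.
have nin t v : t \in z0 :: s -> v \in [:: a; b; c; d] -> t != v.
  by move=> /ds nt Sv; apply: contraNneq nt => ->.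
have o1 : odd_cycle e (w :: [::] ++ w' :: [:: g]).
  by rewrite odd_cycle_split /= eww' ew'g e_sym ewg !inE !negb_or ww' wg ge.
have [od1 _] : odd (size (z0 :: s)) /\ ([::] = [::] :> seq T \/ [:: g] = [::]).
  apply: (odd_ear (s := z0 :: s) e_sym Gs o1 ps us); last by left.
  by move=> t /nin ti; rewrite !inE !negb_or; apply/and3P; split; apply: ti.
have o2 : odd_cycle e (w :: [::] ++ g :: [:: h]).
  by rewrite odd_cycle_split /= ewg egh e_sym ewh !inE !negb_or wg wh gh.
have [od2 _] : odd (size (rcons (z0 :: s) w')) /\ ([::] = [::] :> seq T \/ [:: h] = [::]).
  apply: (odd_ear e_sym Gs o2); last by left.
  - by rewrite rcons_path ps last_rcons.
  - by rewrite rcons_uniq us andbT; apply/negP => /ds; rewrite Sw'.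
  - move=> t; rewrite mem_rcons inE => /predU1P[->|/nin ti].
      by rewrite !inE !negb_or eq_sym ww' ge w'h.
    by rewrite !inE !negb_or; apply/and3P; split; apply: ti.
by move: od1 od2; rewrite size_rcons /= => /negbTE ->.
Qed.

End Nonseparable.

Ltac count_lia :=
  do 4 rewrite -?cats1 ?(count_cat, count_rev) /=;
  repeat match goal with |- context [nat_of_bool ?b] => generalize (nat_of_bool b); intro end;
  repeat match goal with |- context [count ?f ?s] => generalize (count f s); intro end;
  clear; lia.

(** * Two odd cycles with a common edge *)

Section Theta.
Variables (T : finType) (e : rel T).
Hypotheses (e_sym : symmetric e) (e_irr : irreflexive e) (Gs : in_Gstar e).
Hypothesis ns : nonseparable e.
Implicit Types (p q s : seq T) (x y z : T) (A : {set T}).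

Lemma odd_ear_count x p1 y p2 s : odd_cycle e (x :: p1 ++ y :: p2) ->
  path e x (rcons s y) -> (forall a, count_mem a (s ++ x :: p1 ++ y :: p2) <= 1) ->
  s <> [::] \/ (p1 <> [::] /\ p2 <> [::]) ->
  odd (size s) /\ (p1 = [::] \/ p2 = [::]).
Proof.
move=> oC sP /count_le1_uniq; rewrite cat_uniq => /and3P[us /hasPn H _] ne.
apply: (odd_ear e_sym Gs oC sP us _ ne) => z zs.
by apply/negP => /H; rewrite /= zs.
Qed.

Lemma odd_cycle_edge u v p : odd_cycle e [:: u, v & p] =
  [&& e u v, path e v (rcons p u), uniq [:: u, v & p] & odd (size p)].
Proof. by have := odd_cycle_split e u [::] v p; rewrite /= andbT => ->. Qed.

(** An edge leaving the first cycle at [w] starts an ear [s]. If [s] avoids [p'], it is odd and its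
    ends are adjacent on the cycle; the detour through [s] turns [p] into an even ear of the second
    cycle. If [s] meets [p'], first at [c], the routes from [w] through [c] to [u] and to [v] are
    ears that shrink the first cycle to the triangle [uvw], and then [u], [v], [w], [c] span K4. *)
Lemma theta_closed u v p p' w z :
  odd_cycle e [:: u, v & p] -> odd_cycle e [:: u, v & p'] -> {in p, forall a, a \notin p'} ->
  (forall a b c d, ~~ complete4 e a b c d) ->
  w \in p -> e w z -> [set w; z] \in cycle_edges [:: u, v & p].
Proof.
move=> oC oC' dis noK wp ewz.
have [//|nE] := boolP ([set w; z] \in cycle_edges [:: u, v & p]).
have zC : z \notin [:: u, v & p].
  apply: contra nE => zC; apply: (odd_cycle_chordless e_sym e_irr Gs) => //.
  by rewrite !inE wp !orbT.
have := oC; rewrite odd_cycle_edge => /and4P[euv pP uC odC].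
have := oC'; rewrite odd_cycle_edge => /and4P[_ p'P uC' odC'].
have uw : u != w.
  by move: uC; rewrite /= inE negb_or => /andP[/andP[_ up] _]; apply: contraNneq up => ->.
have wC : w \in [:: u, v & p] by rewrite !inE wp !orbT.
have [w' [s0]] := ear_exists e_sym ns (S := mem [:: u, v & p]) wC zC ewz (mem_head _ _) uw euv.
set s := z :: s0; rewrite -rcons_cons -/s => -[/andP[w'C w'w] sP us ds].
have {nE zC} sne : s <> [::] by [].
clearbody s; clear s0.
have dsC a : count_mem a (s ++ [:: u, v & p]) <= 1.
  apply: uniq_count_le1; rewrite cat_uniq us uC andbT andTb.
  by apply/hasPn => b bC; apply/negP => /ds; rewrite inE bC.
have dpp a : count_mem a (p ++ [:: u, v & p']) <= 1.
  apply: uniq_count_le1; rewrite cat_uniq uC'; move: uC.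
  rewrite !cons_uniq inE negb_or => /and3P[/andP[_ up] vp ->]; rewrite andbT /=.
  rewrite negb_or up negb_or vp /=.
  by apply/hasPn => b bp'; apply/negP => /dis; rewrite bp'.
move: pP odC dis dsC dpp oC w'C {ds uC wC}; case/splitPr: wp => p1 p2.
rewrite rcons_cat rcons_cons cat_path /= => /and3P[p1P lw p2P] odC dis dsC dpp oC w'C.
have ER : w :: p2 ++ [:: u, v & p1] = rot (size [:: u, v & p1]) ([:: u, v & p1] ++ w :: p2).
  by rewrite rot_size_cat.
have oR : odd_cycle e (w :: p2 ++ [:: u, v & p1]) by rewrite ER odd_cycle_rot.
have [sp'|sp'] := boolP (has (mem p') s); last first.
  have dsp a : count_mem a (s ++ p') <= 1.
    apply: uniq_count_le1; rewrite cat_uniq us.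
    move: uC'; rewrite !cons_uniq => /and3P[_ _ ->]; rewrite andbT /=.
    by apply: contra sp' => /hasP[b b1 b2]; apply/hasP; exists b.
  (* Rerouting [p] through [s] gives an ear of even length for the cycle through [p']. *)
  have key m : perm_eq m (s ++ p1 ++ w :: p2) -> path e v (rcons m u) -> odd (size s) -> False.
    move=> pm mP ods.
    have oD : odd_cycle e (v :: p' ++ [:: u]).
      by rewrite (_ : v :: _ = rot 1 [:: u, v & p']) ?odd_cycle_rot //= rot1_cons cats1.
    have [||odm _] := @odd_ear_count _ _ _ _ m oD mP.
    - move=> a; rewrite count_cat (permP pm); move: (dsC a) (dpp a) (dsp a).
      by count_lia.
    - by left=> m0; have := perm_size pm; rewrite m0 !size_cat /= !addnS.
    - by move: ods odm odC; rewrite (perm_size pm) !size_cat /=; clear; lia.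
  have : w' \in p2 ++ [:: u, v & p1].
    have: w' \in w :: p2 ++ [:: u, v & p1] by rewrite ER mem_rot.
    by rewrite inE (negbTE w'w).
  move Eq: (p2 ++ _) => q w'q; case/splitPr: w'q Eq => q1 q2 Eq.
  rewrite Eq in oR.
  have [||ods [q0|q0]] := odd_ear_count oR sP; last 2 first.
  - case: (key (p1 ++ w :: s ++ p2)) => //.
      by apply/permP => a; rewrite !count_cat /= ?count_cat ?count_rev; clear; lia.
    have [r Er] : exists r, rcons p2 u = w' :: r.
      by rewrite q0 in Eq; case: (p2) Eq => [|b p3] /= [-> _]; eexists.
    rewrite rcons_cat cat_path p1P rcons_cons /= lw rcons_cat Er -cat_rcons cat_path sP last_rcons.
    by move: p2P; rewrite Er => /andP[].
  - case: (key (p1 ++ rev s ++ w :: p2)) => //.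
      by apply/permP => a; rewrite !count_cat /= ?count_cat ?count_rev; clear; lia.
    have El : last v p1 = w'.
      by have := congr1 (last v) Eq; rewrite q0 !last_cat.
    rewrite rcons_cat cat_path p1P El rcons_cat rcons_cons -cat_rcons cat_path.
    by rewrite -(path_rev e_sym) sP last_rcons.
  - move=> a; have := dsC a; rewrite -Eq; count_lia.
  - by left.
case: (first_in sp') => t [c [t' [Es /= cp' tp']]].
move: p'P odC' oC' dpp tp' {dis sp' uC'}; case/splitPr: cp' => s1 s2.
rewrite rcons_cat rcons_cons -cat_rcons cat_path last_rcons => /andP[s1P s2P] odC' oC' dpp tp'.
have tP : path e w (rcons t c).
  by move: sP; rewrite Es rcons_cat rcons_cons -cat_rcons cat_path => /andP[].
have U a : count_mem a (t ++ c :: s1 ++ s2 ++ [:: u, v & p1 ++ w :: p2]) <= 1.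
  have := dsC a; have := dpp a; rewrite Es !count_cat /= !count_cat /=.
  have := tp' a; rewrite -!has_pred1 !has_count; count_lia.
have [|||odd1 p20] := @odd_ear_count _ _ _ _ (t ++ c :: s2) oR.
- by rewrite rcons_cat rcons_cons -cat_rcons cat_path last_rcons tP s2P.
- by move=> a; have := U a; count_lia.
- by left; case: (t).
have {}p20 : p2 = [::] by case: p20.
have oR' : odd_cycle e (w :: rcons p2 u ++ v :: p1) by rewrite cat_rcons.
have [|||odd2 p10] := @odd_ear_count _ _ _ _ (t ++ c :: rev s1) oR'.
- rewrite rcons_cat rcons_cons -cat_rcons cat_path last_rcons tP.
  by rewrite -(path_rev e_sym).
- move=> a; have := U a; count_lia.
- by left; case: (t).
have {}p10 : p1 = [::] by case: p10 => //; rewrite p20.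
rewrite p10 p20 /= in U lw p2P.
have euw : e u w by rewrite e_sym; case/andP: p2P.
have s1P' : path e c (rcons (rev s1) v) by rewrite -(path_rev e_sym).
(* Each of [t], [s1], [s2] is in turn an arc of an odd cycle with an ear. The opposite arc has an
   inner vertex, so the arc in question is a single edge. *)
have t0 : t = [::].
  have o : odd_cycle e (c :: rcons s2 u ++ w :: t).
    have uo : uniq (c :: rcons s2 u ++ w :: t).
      by apply: count_le1_uniq => a; have := U a; count_lia.
    rewrite odd_cycle_split uo rcons_path s2P last_rcons euw tP size_rcons.
    by move: odd1; rewrite size_cat /=; clear; lia.
  have [|||_ []] := @odd_ear_count _ _ _ _ (rcons (rev s1) v) o.
  - by rewrite rcons_path s1P' last_rcons.
  - move=> a; have := U a; count_lia.
  - by left; case: (rev s1).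
  - by case: (s2).
  - by [].
rewrite {}t0 /= in tP U odd1 odd2; rewrite andbT in tP.
have s10 : s1 = [::].
  have o : odd_cycle e (c :: rev s1 ++ v :: [:: w]).
    have uo : uniq (c :: rev s1 ++ v :: [:: w]).
      by apply: count_le1_uniq => a; have := U a; count_lia.
    rewrite odd_cycle_split uo s1P' /= lw tP /= size_rev.
    by move: odd2; rewrite size_rev; clear; lia.
  have [|||_ []] := @odd_ear_count _ _ _ _ (rcons s2 u) o.
  - by rewrite rcons_path s2P last_rcons.
  - move=> a; have := U a; count_lia.
  - by left; case: (s2).
  - by move/(congr1 rev); rewrite revK.
  - by [].
have s20 : s2 = [::].
  have o : odd_cycle e (c :: s2 ++ u :: [:: w]).
    have uo : uniq (c :: s2 ++ u :: [:: w]).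
      by apply: count_le1_uniq => a; have := U a; count_lia.
    rewrite odd_cycle_split uo s2P /= euw tP /=.
    by move: odd1; clear; lia.
  have [|||_ []] := @odd_ear_count _ _ _ _ (rcons (rev s1) v) o.
  - by rewrite rcons_path s1P' last_rcons e_sym.
  - move=> a; have := U a; count_lia.
  - by left; case: (rev s1).
  - by [].
  - by [].
have := noK u v w c; rewrite /complete4 euv euw lw tP.
rewrite s10 s20 /= !andbT in s1P s2P.
by rewrite e_sym s2P s1P.
Qed.

End Theta.

(** * Structure of nonseparable graphs with an odd cycle and without K4 *)

Section Structure.
Variables (T : finType) (e : rel T).
Hypotheses (e_sym : symmetric e) (e_irr : irreflexive e) (Gs : in_Gstar e).
Implicit Types (p q s : seq T) (x y z : T) (A : {set T}).

(** Quantifying over tuples of bounded length makes the property boolean; the bound loses nothing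
    because cycles repeat no vertex. *)
Definition on_odd_cycle u v x :=
  [exists n : 'I_(#|T|).+1, [exists t : n.-tuple T, odd_cycle e [:: u, v & t] && (x \in t)]].

Lemma on_odd_cycleP u v x :
  reflect (exists2 p, odd_cycle e [:: u, v & p] & x \in p) (on_odd_cycle u v x).
Proof.
apply: (iffP existsP) => [[n /existsP[t /andP[ot xt]]]|[p op xp]]; first by exists t.
have sp : size p < #|T|.+1.
  have := odd_cycle_uniq op; rewrite !cons_uniq => /and3P[_ _ /card_uniqP <-].
  by rewrite ltnS max_card.
exists (Ordinal sp); apply/existsP; exists (in_tuple p).
by rewrite op.
Qed.

(** The local form of the theta structure. It gives both facts needed for colouring: [x] has degree
    at most two, and an odd cycle through [x] must use the edge [uv]. *)
Definition captured u v x := exists p, [/\ odd_cycle e [:: u, v & p], x \in p &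
  forall z, e x z -> [set x; z] \in cycle_edges [:: u, v & p]].

Lemma captured_degree u v x : captured u v x -> #|[set z | e x z]| <= 2.
Proof.
case=> p [op xp H]; have up := odd_cycle_uniq op.
have xC : x \in [:: u, v & p] by rewrite !inE xp !orbT.
have sub : [set z | e x z] \subset [set next [:: u, v & p] x; prev [:: u, v & p] x].
  apply/subsetP => z; rewrite inE => /H zE.
  by rewrite !inE; case: (mem_cycle_edgesP up xC zE) => <-; rewrite eqxx ?orbT.
by apply: leq_trans (subset_leq_card sub) _; rewrite cards2; case: eqP.
Qed.

(** [D] has a vertex other than [u] and [v]. Its two edges on [D] also lie on the odd cycle
    capturing it, so the two cycles have the same edges, [uv] among them. *)
Lemma captured_odd_cycle u v D : (forall x z, e x z -> x != u -> x != v -> captured u v x) ->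
  odd_cycle e D -> [set u; v] \in cycle_edges D.
Proof.
move=> H oD; have uD := odd_cycle_uniq oD.
have sD : 2 < size D by case/andP: oD => /andP[].
have [x xD xuv] : exists2 x, x \in D & (x != u) && (x != v).
  apply/hasP; apply: contraLR sD => /hasPn sub; rewrite -leqNgt.
  apply: (@uniq_leq_size _ D [:: u; v]) => // x /sub.
  by rewrite negb_and !negbK !inE.
have [E1 E2 E12] := next_prev_edges uD sD xD.
have cD : cycle e D by case/andP: oD => /andP[/andP[]].
have e1 : e x (next D x) by apply: next_cycle.
have e2 : e x (prev D x) by rewrite e_sym; apply: prev_cycle.
case/andP: xuv => xu xv; have [p [op xp xE]] := H _ _ e1 xu xv.
rewrite (Gstar_eq Gs oD op E12) //; first exact: cycle_edges_head.
- exact: xE.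
- exact: xE.
Qed.

Hypothesis ns : nonseparable e.
Hypothesis noK : forall a b c d, ~~ complete4 e a b c d.

(** At the common vertex [x] both edges of the second cycle lie on the first, so the cycles have
    equal edge sets. *)
Lemma chord_free_transfer u v p : odd_cycle e [:: u, v & p] ->
  (forall x, x \in p -> forall z, e x z -> [set x; z] \in cycle_edges [:: u, v & p]) ->
  forall p0, odd_cycle e [:: u, v & p0] -> forall x, x \in p0 -> x \in p ->
  forall y, y \in p0 -> forall z, e y z -> [set y; z] \in cycle_edges [:: u, v & p0].
Proof.
move=> op cl p0 op0 x xp0 xp y yp0 z eyz.
set D := [:: u, v & p0] in op0 *.
have uD := odd_cycle_uniq op0.
have sD : 2 < size D by case/andP: op0 => /andP[].
have xD : x \in D by rewrite !inE xp0 !orbT.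
have cD : cycle e D by case/andP: op0 => /andP[/andP[]].
have [E1 E2 E12] := next_prev_edges uD sD xD.
have EE : cycle_edges D = cycle_edges [:: u, v & p].
  apply: (Gstar_eq Gs op0 op E12) => //; apply: cl => //.
    exact: next_cycle.
  by rewrite e_sym; apply: prev_cycle.
have yD : y \in D by rewrite !inE yp0 !orbT.
have [Ey _ _] := next_prev_edges uD sD yD.
have : y \in [:: u, v & p].
  by rewrite EE in Ey; apply: (cycle_edges_sub Ey); rewrite set21.
rewrite EE !inE => /or3P[/eqP yu|/eqP yv|/cl]; last by apply.
  by move: uD; rewrite /= -yu inE yp0 orbT.
by move: uD; rewrite /= -yv yp0 andbF.
Qed.

(** Any odd cycle through [uv] either meets [p] inside, and is closed by transfer, or is disjoint
    from [p] there, and is closed by [theta_closed]. Hence inner vertices have no neighbour outside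
    [S]; a vertex beyond [S] would give an ear leaving at [v] and returning at [u], which is odd and
    puts its own vertices into [S]. *)
Lemma theta_captured u v p p' : odd_cycle e [:: u, v & p] -> odd_cycle e [:: u, v & p'] ->
  {in p, forall a, a \notin p'} ->
  forall x z, e x z -> x != u -> x != v -> captured u v x.
Proof.
move=> op op' dis.
have cl : forall x, x \in p -> forall z, e x z -> [set x; z] \in cycle_edges [:: u, v & p].
  by move=> x xp z; apply: theta_closed op op' dis noK xp.
have cl0 p0 : odd_cycle e [:: u, v & p0] ->
    forall x, x \in p0 -> forall z, e x z -> [set x; z] \in cycle_edges [:: u, v & p0].
  move=> op0; have [/hasP[x xp0 xp]|/hasPn dis0] := boolP (has (mem p) p0).
    exact: (chord_free_transfer op cl op0 xp0 xp).
  by move=> x xp0 z; apply: theta_closed op0 op _ noK xp0 => // a /dis0.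
have := op; rewrite odd_cycle_edge // => /and4P[euv pP up odp].
have evu : e v u by rewrite e_sym.
pose S x := [|| x == u, x == v | on_odd_cycle u v x].
have S_nbr x z : on_odd_cycle u v x -> e x z -> S z.
  case/on_odd_cycleP => p0 op0 xp0 /(cl0 _ op0 _ xp0)/cycle_edges_sub/(_ (set22 _ _)).
  rewrite /S !inE => /or3P[->|->|zp0]; rewrite ?orbT //.
  by apply/or3P; apply: Or33; apply/on_odd_cycleP; exists p0.
suff all_S x z : e x z -> S x.
  move=> x z exz xu xv; have := all_S _ _ exz; rewrite /S (negbTE xu) (negbTE xv) /=.
  case/on_odd_cycleP => p0 op0 xp0; exists p0; split=> //; exact: cl0.
move=> exz; apply: contraT => nSx.
have vu : v != u by apply: contraTneq euv => ->; rewrite e_irr.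
have xu : x != u by apply: contraNneq nSx => ->; rewrite /S eqxx.
have Sv : S v by rewrite /S eqxx orbT.
have [a [b [nSa Sb /and3P[_ bu eab]]]] := crossing (ns xu vu exz evu) nSx Sv.
have bv : b = v.
  apply/eqP; move: Sb; rewrite {1}/S (negbTE bu) /= => /orP[//|bS].
  by rewrite e_sym in eab; rewrite (S_nbr _ _ bS eab) in nSa.
rewrite {}bv e_sym in eab.
have Su : S u by rewrite /S eqxx.
rewrite eq_sym in vu.
have [w' [s [/andP[Sw' w'v] sP us ds]]] := ear_exists e_sym ns Sv nSa eab Su vu euv.
have w'u : w' = u.
  apply/eqP; move: Sw'; rewrite {1}/S (negbTE w'v) /= => /orP[//|w'S].
  have ew't : e w' (last a s).
    by move: sP; rewrite -rcons_cons rcons_path /= [e (last a s) _]e_sym => /andP[].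
  by have := ds (last a s); rewrite mem_last (S_nbr _ _ w'S ew't) => /(_ isT).
rewrite {}w'u -rcons_cons in sP.
have oD : odd_cycle e (v :: p ++ [:: u]).
  by rewrite (_ : v :: _ = rot 1 [:: u, v & p]) ?odd_cycle_rot //= rot1_cons cats1.
have pS t : t \in v :: p ++ [:: u] -> S t.
  rewrite inE mem_cat inE /S => /or3P[->|tp|->]; rewrite ?orbT //.
  by apply/or3P; apply: Or33; apply/on_odd_cycleP; exists p.
have [ods _] : odd (size (a :: s)) /\ (p = [::] \/ [::] = [::] :> seq T).
  apply: (odd_ear e_sym Gs oD sP us); last by left.
  by move=> t /ds; apply: contra => /pS.
have oas : odd_cycle e [:: u, v & a :: s].
  rewrite odd_cycle_edge euv sP ods andbT 2!cons_uniq us andbT inE negb_or vu /=.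
  by apply/andP; split; apply/negP => /ds; rewrite ?Sv ?Su.
have : S a by apply/or3P; apply: Or33; apply/on_odd_cycleP; exists (a :: s); rewrite ?mem_head.
by rewrite (negbTE nSa).
Qed.

(** If no edge leaves [C], any edge of [C] serves as [uv]. Otherwise an ear of [C] is odd and joins
    adjacent vertices of [C]; their edge, the remaining arc and the ear form the theta. *)
Lemma nonseparable_structure C : odd_cycle e C ->
  exists u v, e u v /\ forall x z, e x z -> x != u -> x != v -> captured u v x.
Proof.
move=> oC; have [cl|] := boolP [forall w in C, forall z, e w z ==> (z \in C)].
  have {}cl w z : w \in C -> e w z -> z \in C.
    by move=> wC ewz; move/forall_inP: cl => /(_ w wC)/forallP/(_ z)/implyP; apply.
  have sC : 2 < size C by case/andP: oC => /andP[].
  case: C sC oC cl => [|u [|v p]] // _ oC cl; exists u, v.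
  have := oC; rewrite odd_cycle_edge => /and4P[euv _ uC _]; split=> // x z exz xu xv.
  have uv : u != v by apply: contraTneq euv => ->; rewrite e_irr.
  have xC : x \in [:: u, v & p].
    apply: contraT => nx.
    have [a [b [na Sb /and3P[_ _ eab]]]] :=
      crossing (S := mem [:: u, v & p]) (ns xv uv exz euv) nx (mem_head _ _).
    by rewrite e_sym in eab; rewrite /= (cl _ _ Sb eab) in na.
  exists p; split=> //; first by move: xC; rewrite !inE (negbTE xu) (negbTE xv).
  by move=> t ext; apply: (odd_cycle_chordless e_sym e_irr Gs) => //; apply: cl ext.
case/forall_inPn => w wC /forallPn[z]; rewrite negb_imply => /andP[ewz zC].
have [y yC [yw [y' ey]]] : exists2 y, y \in C & y != w /\ exists y', e y y'.
  have uC := odd_cycle_uniq oC; have cC : cycle e C by case/andP: oC => /andP[/andP[]].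
  have en : e w (next C w) by apply: next_cycle.
  exists (next C w); rewrite ?mem_next //; split.
    by apply: contraTneq en => ->; rewrite e_irr.
  by exists w; rewrite e_sym.
have [w' [s [/andP[w'C w'w] sP us ds]]] := ear_exists e_sym ns (S := mem C) wC zC ewz yC yw ey.
case: (rot_to wC) => i q Eq.
have oR : odd_cycle e (w :: q) by rewrite -Eq odd_cycle_rot.
have mR x : x \in C -> x \in w :: q by rewrite -Eq mem_rot.
have mR' x : x \in w :: q -> x \in C by rewrite -Eq mem_rot.
have : w' \in q by have := mR _ w'C; rewrite inE (negbTE w'w).
move=> w'q; move: oR mR' {Eq mR}; case/splitPr: w'q => q1 q2 oR mR'.
rewrite -rcons_cons in sP.
have [od q0] : odd (size (z :: s)) /\ (q1 = [::] \/ q2 = [::]).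
  apply: (odd_ear e_sym Gs oR sP us); last by left.
  by move=> t /ds; apply: contra => /mR'.
have := oR; rewrite odd_cycle_split => /and4P[P1 P2 uR odq].
have ww' : w != w' by rewrite eq_sym.
have out x : x \in w :: q1 ++ w' :: q2 -> x \notin z :: s.
  by move/mR' => xC; apply/negP => /ds; rewrite inE xC.
have wout : w \notin z :: s by apply: out; rewrite mem_head.
have w'out : w' \notin z :: s by apply: out; rewrite inE mem_cat mem_head !orbT.
case: q0 => q0; rewrite {}q0 in oR P1 P2 uR odq out.
  exists w, w'; split; first by move: P1; rewrite /= andbT.
  apply: (@theta_captured _ _ q2 (rev (z :: s))) => //.
  - rewrite odd_cycle_edge -(path_rev e_sym) sP size_rev od andbT 2!cons_uniq rev_uniq us.
    rewrite !mem_rev inE negb_or mem_rev ww' wout w'out !andbT.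
    by move: P1; rewrite /= andbT.
  - by move=> x xq; rewrite mem_rev; apply: out; rewrite !inE xq !orbT.
have eww' : e w' w by move: P2; rewrite /= andbT.
exists w', w; split => //.
apply: (@theta_captured _ _ q1 (z :: s)).
- rewrite (_ : [:: w', w & q1] = rot (size (w :: q1)) ((w :: q1) ++ [:: w'])) ?odd_cycle_rot //.
  by rewrite rot_size_cat.
- by rewrite odd_cycle_edge eww' sP od andbT 2!cons_uniq us inE negb_or eq_sym ww' wout w'out.
- by move=> x xq; apply: out; rewrite inE mem_cat xq orbT.
Qed.

End Structure.

(** * Edge sets and list colouring *)

Section Bipartition.
Variables (T : finType) (e : rel T).
Hypothesis e_sym : symmetric e.

Lemma not_uniq_split (p : seq T) : ~~ uniq p ->
  exists a x b c, p = a ++ x :: b ++ x :: c.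
Proof.
elim: p => //= x p IH; rewrite negb_and negbK => /orP[|/IH[a [y [b [c ->]]]]].
  by case/splitPr => b c; exists [::], x, b, c.
by exists (x :: a), y, b, c.
Qed.

(** A repeated vertex splits the walk into two shorter closed walks, one of them odd. *)
Lemma odd_closed_walk_odd_cycle (p : seq T) : irreflexive e -> cycle e p -> odd (size p) ->
  exists C, odd_cycle e C.
Proof.
move=> e_irr; move En: (size p) => n; elim/ltn_ind: n p En => n IH p En cp on.
have [up|/not_uniq_split[a [x [b [c Ep]]]]] := boolP (uniq p).
  exists p; rewrite /odd_cycle /is_cycle /ucycleb cp up En on andbT /=.
  case: n on En {IH} => [|[|[|n]]] //= _; case: p cp {up} => [|x [|y p]] //=.
  by rewrite e_irr.
have cp' : cycle e ((x :: b ++ x :: c) ++ a) by rewrite -rot_size_cat rot_cycle -Ep.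
move: cp'; rewrite /= -catA /= rcons_cat rcons_cons -cat_rcons cat_path last_rcons.
case/andP => c1 c2.
have := congr1 size Ep; rewrite !size_cat /= size_cat /= En => sE.
have [o1|o1] := boolP (odd (size b).+1).
  by apply: (IH (size b).+1 _ (x :: b)) => //; lia.
by apply: (IH (size (c ++ a)).+1 _ (x :: c ++ a)) => //; rewrite size_cat; lia.
Qed.

(** Connectivity in the bipartite double cover on [T * bool]: joining the two copies of a vertex
    gives an odd closed walk. If this never happens, the copy reached from the [false] copy of the
    component's root tells the side of a vertex. *)
Lemma odd_cycle_or_bipartition : irreflexive e ->
  (exists C, odd_cycle e C) \/
  exists X : {set T}, forall x y, e x y -> (x \in X) != (y \in X).
Proof.
move=> e_irr.
pose r (a b : T * bool) := e a.1 b.1 && (b.2 == ~~ a.2).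
have r_sym : connect_sym r.
  by apply: sym_connect_sym => -[x b] [y c]; rewrite /r /= e_sym; case: b c => [] [].
have ec : connect_sym e by apply: sym_connect_sym.
have walk x b p : path r (x, b) p ->
    path e x (map fst p) /\ (last (x, b) p).2 = b (+) odd (size p).
  elim: p x b => [|[y c] p IH] x b /=; first by rewrite addbF.
  case/andP => /andP[/= -> /eqP /= ->] /IH[-> ->]; split=> //.
  by case: b (odd _) => [] [].
have lift x p b : path e x p -> exists c, connect r (x, b) (last x p, c).
  elim: p x b => [|y p IH] x b /=; first by exists b; apply: connect0.
  case/andP => exy /(IH _ (~~ b))[c yc]; exists c; apply: connect_trans yc.
  by apply: connect1; rewrite /r /= exy eqxx.
have [/existsP[x /connectP[p pp pl]]|/existsPn noT] :=
    boolP [exists x, connect r (x, false) (x, true)].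
  left; have [ep] := walk _ _ _ pp.
  rewrite -pl /= => op.
  have lx : last x (map fst p) = x by rewrite (last_map fst p (x, false)) -pl.
  case/lastP: p op ep lx {pp pl} => // p [y c].
  rewrite map_rcons last_rcons size_rcons /= => op ep yx.
  apply: (@odd_closed_walk_odd_cycle (x :: map fst p)) => //.
    by rewrite /= -{2}yx.
  by rewrite /= size_map -op.
right; exists [set x | connect r (root e x, false) (x, true)] => x y exy; rewrite !inE.
have <- : root e x = root e y by apply/(rootP ec); apply: connect1.
set z := root e x.
have step b : connect r (z, false) (x, b) -> connect r (z, false) (y, ~~ b).
  by move/connect_trans; apply; apply: connect1; rewrite /r /= exy eqxx.
have [b zb] : exists b, connect r (z, false) (x, b).
  have : connect e z x by rewrite ec; apply: connect_root.
  by case/connectP => p pp ->; apply: lift pp.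
case xT: (connect r (z, false) (x, true)).
  apply/eqP => /esym yT; have := noT y; rewrite (connect_trans _ yT) //.
  by rewrite r_sym; apply: step xT.
by case: b zb xT => [->//|/step /= -> _].
Qed.

End Bipartition.

Section EdgeSets.
Variable T : finType.
Implicit Types (E F : {set {set T}}) (A B X Y : {set T}) (a b v r : T).

Definition vdeg E v := #|[set A in E | v \in A]|.

Definition eproper (C : eqType) E (c : {set T} -> C) :=
  forall A B, A \in E -> B \in E -> A != B -> A :&: B != set0 -> c A != c B.

Definition lcolorable (Q : finType) E (L : {set T} -> {set Q}) :=
  exists c : {set T} -> Q, eproper E c /\ forall A, A \in E -> c A \in L A.

Definition bipartite (X : {set T}) E :=
  forall A, A \in E -> exists a b, [/\ a \in X, b \notin X & A = [set a; b]].

Lemma bipartiteC X E : bipartite X E -> bipartite (~: X) E.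
Proof.
move=> H A /H[a [b [aX bX ->]]]; exists b, a.
by rewrite !inE aX bX setUC.
Qed.

(** The maps [end_in X] and [end_in (~: X)] are the end maps of the abstract bipartite setting; on
    the edges of a bipartite [E] neither of them is [None]. *)
Definition end_in (X A : {set T}) := [pick a in A | a \in X].

Lemma end_inE X a b : a \in X -> b \notin X -> end_in X [set a; b] = Some a.
Proof.
move=> aX bX; rewrite /end_in; case: pickP => [c|/(_ a)]; last by rewrite !inE eqxx aX.
rewrite !inE => /andP[/orP[]/eqP -> //]; by rewrite (negbTE bX).
Qed.

Lemma end_in_mem X E A v : bipartite X E -> A \in E -> v \in X ->
  (end_in X A == Some v) = (v \in A).
Proof.
move=> H /H[a [b [aX bX ->]]] vX; rewrite end_inE // !inE.
have -> : (Some a == Some v) = (a == v) by [].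
by have [vb|_] := eqVneq v b; [rewrite -vb vX in bX | rewrite orbF eq_sym].
Qed.

Lemma fdeg_end_in X E o : bipartite X E ->
  fdeg (end_in X) E o = if o is Some v then if v \in X then vdeg E v else 0 else 0.
Proof.
move=> H; rewrite /fdeg; case: o => [v|].
  have [vX|vX] := boolP (v \in X).
    apply: eq_card => A; rewrite !inE; case AE: (A \in E) => //=.
    exact: end_in_mem H AE vX.
  apply: eq_card0 => A; rewrite !inE; apply/negP => /andP[/H[a [b [aX bX ->]]]].
  by rewrite end_inE // => /eqP[av]; rewrite -av aX in vX.
apply: eq_card0 => A; rewrite !inE; apply/negP => /andP[/H[a [b [aX bX ->]]]].
by rewrite end_inE.
Qed.

Lemma bipartite_rooted (Q : finType) (q0 : Q) X E (L : {set T} -> {set Q}) k r :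
  bipartite X E -> (forall v, vdeg E v <= k) ->
  (forall A, A \in E -> (if r \in A then vdeg E r else k) <= #|L A|) ->
  lcolorable E L.
Proof.
(* [galvin_rooted] has its special vertex on the [f] side; the sides can be exchanged. *)
wlog rX : X / r \in X => [W|] H dE LE.
  have [rX|rX] := boolP (r \in X); first exact: W X rX H dE LE.
  by apply: (W (~: X)) => //; [rewrite inE | apply: bipartiteC].
have H' := bipartiteC H.
have dX Y : bipartite Y E -> forall o, fdeg (end_in Y) E o <= k.
  by move=> HY o; rewrite fdeg_end_in //; case: o => // v; case: ifP.
have [|c [cP cL]] := galvin_rooted q0 (L := L) (r := Some r) (dX _ H) (dX _ H').
  move=> A AE; rewrite (end_in_mem H AE rX) fdeg_end_in // rX; exact: LE.
exists c; split=> // A B AE BE nAB /set0Pn[v]; rewrite inE => /andP[vA vB].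
apply: cP => //; apply/orP; have [vX|vX] := boolP (v \in X).
  left; have /eqP -> : end_in X A == Some v by rewrite (end_in_mem H).
  by rewrite eq_sym (end_in_mem H).
right; have /eqP -> : end_in (~: X) A == Some v by rewrite (end_in_mem H') // inE.
by rewrite eq_sym (end_in_mem H') // inE.
Qed.

End EdgeSets.

Lemma card_D1_leq (Q : finType) (S : {set Q}) q : #|S| <= #|S :\ q|.+1.
Proof. by rewrite (cardsD1 q S); case: (q \in S). Qed.

(** * Choosing colours from small lists *)

Section ColorChoice.
Variable Q : finType.

Lemma pick_color (S : {set Q}) (s : seq Q) : size s < #|S| ->
  exists2 q, q \in S & q \notin s.
Proof.
move=> sS; have /set0Pn[q] : S :\: [set q in s] != set0.
  rewrite -card_gt0 cardsD subn_gt0; apply: leq_ltn_trans sS.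
  apply: leq_trans (subset_leq_card (subsetIr _ _)) _.
  by rewrite cardsE; apply: card_size.
by rewrite !inE => /andP[? ?]; exists q.
Qed.

Lemma subset_of_card (S : {set Q}) n : n <= #|S| -> exists2 M : {set Q}, M \subset S & #|M| = n.
Proof.
move=> nS; exists [set q in take n (enum S)].
  by apply/subsetP => q; rewrite inE => /mem_take; rewrite mem_enum.
rewrite cardsE (card_uniqP _) ?size_take -?cardE; last exact: take_uniq (enum_uniq _).
by move: nS; rewrite leq_eqVlt => /predU1P[->|->]; rewrite ?ltnn.
Qed.

(* The edges [ab], [cd] of K4 can be coloured so that each of the four remaining lists
   keeps two colours: if [A] and [B] are disjoint, each other list, cut down to three
   elements, spoils at most two of the nine pairs. *)
Lemma opposite_pair_colors (A B L1 L2 L3 L4 : {set Q}) :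
  2 < #|A| -> 2 < #|B| -> 2 < #|L1| -> 2 < #|L2| -> 2 < #|L3| -> 2 < #|L4| ->
  exists a b, [/\ a \in A, b \in B &
    [/\ 1 < #|L1 :\ a :\ b|, 1 < #|L2 :\ a :\ b|, 1 < #|L3 :\ a :\ b| & 1 < #|L4 :\ a :\ b|]].
Proof.
move=> cA cB c1 c2 c3 c4.
have [/set0Pn[q]|] := boolP (A :&: B != set0).
  rewrite inE => /andP[qA qB]; exists q, q; split=> //.
  have D (L : {set Q}) : 2 < #|L| -> 1 < #|L :\ q :\ q|.
    move=> cL; have -> : L :\ q :\ q = L :\ q.
      by apply/setP => z; rewrite !inE; case: eqP.
    by rewrite -ltnS (leq_trans cL) // card_D1_leq.
  by split; apply: D.
rewrite negbK setI_eq0 => dAB.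
have trim (L : {set Q}) : 2 < #|L| -> exists2 Z : {set Q * Q}, #|Z| <= 2 &
    forall a b, a \in A -> b \in B -> (a, b) \notin Z -> 1 < #|L :\ a :\ b|.
  (* A pair is harmful only if it removes two colours of [M]. The traces of [A] and [B] on [M] have
     together at most three elements, so their product has at most two. *)
  case/subset_of_card => M /subsetP ML cM; exists (setX (M :&: A) (M :&: B)).
    have : #|M :&: A| + #|M :&: B| <= 3.
      rewrite -cM -cardsUI [X in _ + X](_ : _ = 0) ?addn0.
        by apply: subset_leq_card; rewrite subUset !subsetIl.
      apply/eqP; rewrite cards_eq0 -subset0 -(eqP (_ : A :&: B == set0)) ?setI_eq0 //.
      by apply/subsetP => z; rewrite !inE => /andP[/andP[_ ->] /andP[_ ->]].
    by rewrite cardsX; nia.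
  move=> a b aA bB; rewrite !inE aA bB !andbT negb_and => nab.
  have ab : a != b by apply: contraTneq aA => ->; rewrite (disjointFl dAB).
  apply: leq_trans (subset_leq_card (_ : M :\ a :\ b \subset _)); last first.
    by apply/subsetP => z; rewrite !inE => /and3P[-> -> /ML].
  have := cardsD1 a M; have := cardsD1 b (M :\ a); rewrite !inE eq_sym ab cM.
  by case: (a \in M) nab => /=; case: (b \in M) => //= _; lia.
have [Z1 z1 H1] := trim _ c1; have [Z2 z2 H2] := trim _ c2.
have [Z3 z3 H3] := trim _ c3; have [Z4 z4 H4] := trim _ c4.
have : ~~ (setX A B \subset Z1 :|: Z2 :|: (Z3 :|: Z4)).
  apply/negP => /subset_leq_card; rewrite cardsX.
  move/(leq_trans (leq_mul cA cB))/leq_trans/(_ (leq_of_leqif (leq_card_setU _ _))).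
  have c12 : #|Z1 :|: Z2| <= 4 := leq_trans (leq_of_leqif (leq_card_setU _ _)) (leq_add z1 z2).
  have c34 : #|Z3 :|: Z4| <= 4 := leq_trans (leq_of_leqif (leq_card_setU _ _)) (leq_add z3 z4).
  by move/leq_trans/(_ (leq_add c12 c34)).
case/subsetPn => -[a b]; rewrite !inE !negb_or /= => /andP[aA bB] /andP[/andP[n1 n2] /andP[n3 n4]].
by exists a, b; split=> //; split; [apply: H1|apply: H2|apply: H3|apply: H4].
Qed.

(* List colouring of K4 minus an edge, vertices [u, v, r, s] with [rs] missing:
   [A = L(ur)], [B = L(vr)], [C = L(uv)], [U = L(us)], [V = L(vs)]. *)
Lemma diamond_colors (A B C U V : {set Q}) :
  1 < #|A| -> 1 < #|B| -> 2 < #|C| -> 2 < #|U| -> 2 < #|V| ->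
  exists a b c x y, [/\ a \in A, b \in B, c \in C, x \in U & y \in V] /\
    uniq [:: a; b; c] /\ uniq [:: a; c; x] /\ uniq [:: b; c; y] /\ x != y.
Proof.
move=> cA cB cC cU cV.
(* [ur] and [vs] do not meet, so a common colour serves both and the other edges can be coloured
   greedily; likewise below for [vr] and [us]. *)
have [/set0Pn[q]|AV] := boolP (A :&: V != set0).
  rewrite inE => /andP[qA qV].
  have [b bB] := @pick_color B [:: q] cB; rewrite !inE => qb.
  have [c cC'] := @pick_color C [:: q; b] cC; rewrite !inE negb_or => /andP[cq cb].
  have [x xU] := @pick_color U [:: q; c] cU; rewrite !inE negb_or => /andP[xq xc].
  by exists q, b, c, x, q; split=> //=; rewrite !inE !negb_or ![q == _]eq_sym ![b == c]eq_sym
    ![c == x]eq_sym ?qb cq cb xq xc ?[q == b]eq_sym ?qb.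
have [/set0Pn[q]|BU] := boolP (B :&: U != set0).
  rewrite inE => /andP[qB qU].
  have [a aA] := @pick_color A [:: q] cA; rewrite !inE => qa.
  have [c cC'] := @pick_color C [:: q; a] cC; rewrite !inE negb_or => /andP[cq ca].
  have [y yV] := @pick_color V [:: q; c] cV; rewrite !inE negb_or => /andP[yq yc].
  by exists a, q, c, q, y; split=> //=; rewrite !inE !negb_or ![q == _]eq_sym ![a == c]eq_sym
    ![c == y]eq_sym ?qa cq ca yq yc ?[q == a]eq_sym ?qa.
have nAV q : q \in A -> q \in V -> False.
  by move=> qA qV; case/negP: AV; apply/set0Pn; exists q; rewrite inE qA.
have nBU q : q \in B -> q \in U -> False.
  by move=> qB qU; case/negP: BU; apply/set0Pn; exists q; rewrite inE qB.
have [a aA _] := @pick_color A [::] (ltnW cA).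
have [b bB] := @pick_color B [:: a] cB; rewrite !inE => ba.
have [c cC'] := @pick_color C [:: a; b] cC; rewrite !inE negb_or => /andP[ca cb].
have [x xU] := @pick_color U [:: a; c] cU; rewrite !inE negb_or => /andP[xa xc].
have [/existsP[y /and4P[yV yb yc yx]]|/existsPn noy] :=
    boolP [exists y, [&& y \in V, y != b, y != c & y != x]].
  exists a, b, c, x, y; split=> //=; rewrite !inE !negb_or.
  by rewrite [a == b]eq_sym [a == c]eq_sym [a == x]eq_sym [b == c]eq_sym [c == x]eq_sym
    [b == y]eq_sym [c == y]eq_sym [x == y]eq_sym ba ca xa cb xc yb yc yx.
(* Here [V = {b, c, x}], so [s] may receive [x] from [vs] after recolouring [ur] or [us]. *)
have VE : V = [set b; c; x].
  apply/eqP; rewrite eqEcard; apply/andP; split.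
    by apply/subsetP => y yV; have := noy y; rewrite yV !inE; do 3!case: eqP.
  apply: leq_trans cV; rewrite setUC cardsU1 cards2; by case: (_ \notin _); case: (_ != _).
have xV : x \in V by rewrite VE !inE eqxx !orbT.
have bV : b \in V by rewrite VE !inE eqxx.
have cV' : c \in V by rewrite VE !inE eqxx !orbT.
have xb : x != b by apply/eqP => xb; apply: (nBU b) => //; rewrite -xb.
have [a' a'A] := @pick_color A [:: a] cA; rewrite !inE => a'a.
have a'V y : y \in V -> a' != y.
  by move=> yV; apply/eqP => e; apply: (nAV y) => //; rewrite -e.
have [/existsP[x' /and4P[x'U x'a' x'c x'x]]|/existsPn nox] :=
    boolP [exists x', [&& x' \in U, x' != a', x' != c & x' != x]].
  exists a', b, c, x', x; split=> //=; rewrite !inE !negb_or.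
  by rewrite (a'V b) // (a'V c) // [b == c]eq_sym [a' == x']eq_sym [c == x']eq_sym
    [b == x]eq_sym [c == x]eq_sym cb x'a' x'c xb xc x'x.
have a'U : a' \in U.
  apply: contraT => na'; have : U \subset [set c; x].
    apply/subsetP => y yU; have := nox y; rewrite yU !inE.
    have -> : y != a' by apply: contraNneq na' => <-.
    by do 2!case: eqP.
  by move/subset_leq_card/(leq_trans cU); rewrite cards2; case: (_ != _).
exists a, b, c, a', x; split=> //=; rewrite !inE !negb_or.
by rewrite [a == b]eq_sym [a == c]eq_sym [a == a']eq_sym [b == c]eq_sym
  [c == a']eq_sym [b == x]eq_sym [c == x]eq_sym ba ca a'a cb (a'V c) // xb xc (a'V x).
Qed.

End ColorChoice.

Section Extension.
Variables (T Q : finType).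
Implicit Types (E F : {set {set T}}) (A B X : {set T}) (u v w x y r : T).
Implicit Types (L : {set T} -> {set Q}) (p q : Q).

Definition strike L A q B := if A :&: B != set0 then L B :\ q else L B.

Lemma mem_strike L A q B p :
  (p \in strike L A q B) = (p \in L B) && ((A :&: B != set0) ==> (p != q)).
Proof. by rewrite /strike; case: ifP => _; rewrite ?inE ?andbT // andbC. Qed.

Lemma card_strike L A q B : #|L B| <= #|strike L A q B| + (A :&: B != set0).
Proof. by rewrite /strike; case: ifP => _; rewrite ?addn0 // addn1 card_D1_leq. Qed.

Lemma lcolorable_extend E L A q : A \in E -> q \in L A ->
  lcolorable (E :\ A) (strike L A q) -> lcolorable E L.
Proof.
move=> AE qA [c [cP cL]].
have cE B : B \in E -> B != A -> (c B \in L B) && ((A :&: B != set0) ==> (c B != q)).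
  by move=> BE nBA; rewrite -mem_strike; apply: cL; rewrite !inE nBA.
exists (fun B => if B == A then q else c B); split; last first.
  move=> B BE; case: eqP => [->//|/eqP nBA].
  by case/andP: (cE _ BE nBA).
move=> B C BE CE nBC m; case: (eqVneq B A) => [eB|nB]; case: (eqVneq C A) => [eC|nC].
- by rewrite eB eC eqxx in nBC.
- by have /andP[_ /implyP h] := cE _ CE nC; rewrite eq_sym; apply: h; rewrite -eB.
- by have /andP[_ /implyP h] := cE _ BE nB; apply: h; rewrite -eC setIC.
- by apply: cP; rewrite // !inE ?nB ?nC.
Qed.

Lemma meet2 x y B : ([set x; y] :&: B != set0) = (x \in B) || (y \in B).
Proof.
apply/set0Pn/orP => [[z]|[xB|yB]]; last 2 first.
- by exists x; rewrite !inE eqxx.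
- by exists y; rewrite !inE eqxx orbT.
by rewrite !inE => /andP[/orP[]/eqP ->]; auto.
Qed.

Lemma card2_pair B x y : #|B| = 2 -> x \in B -> y \in B -> x != y -> B = [set x; y].
Proof.
move=> cB xB yB xy; apply/esym/eqP; rewrite eqEcard cB cards2 xy leqnn andbT.
by apply/subsetP => z; rewrite !inE => /orP[]/eqP ->.
Qed.

Lemma vdegD1 E A v : A \in E -> vdeg E v = (v \in A) + vdeg (E :\ A) v.
Proof.
move=> AE; rewrite /vdeg; have [vA|vA] := boolP (v \in A).
  rewrite (cardsD1 A) inE AE vA; congr (_ + _); apply: eq_card => B.
  by rewrite !inE andbA.
by apply: eq_card => B; rewrite !inE; have [->|] := eqVneq B A; rewrite ?(negbTE vA) ?andbF.
Qed.

Lemma vdegS E F v : F \subset E -> vdeg F v <= vdeg E v.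
Proof.
move=> /subsetP FE; apply: subset_leq_card; apply/subsetP => A.
by rewrite !inE => /andP[/FE -> ->].
Qed.

Lemma vdeg_gt0 E A v : A \in E -> v \in A -> 0 < vdeg E v.
Proof. by move=> AE vA; rewrite (vdegD1 v AE) vA. Qed.

Lemma bipartiteS X E F : F \subset E -> bipartite X E -> bipartite X F.
Proof. by move=> /subsetP FE H A /FE/H. Qed.

End Extension.

(** * Colouring the blocks *)

Ltac nat_lia :=
  repeat match goal with
  | H : is_true (leq _ _) |- _ => revert H
  | H : @eq nat _ _ |- _ => revert H
  end; clear; lia.

Section Blocks.
Variables (T Q : finType) (q0 : Q).
Implicit Types (E F G : {set {set T}}) (A B X : {set T}) (u v w x y r s t : T).
Implicit Types (L : {set T} -> {set Q}) (p q : Q).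

Definition two_uniform E := forall A, A \in E -> #|A| = 2.

(** After [ab] and [cd] are coloured by [opposite_pair_colors], a 4-cycle with lists of two colours
    remains. It is bipartite of maximum degree two, so any root will do. *)
Lemma complete4_colorable E L a b c d : uniq [:: a; b; c; d] ->
  E = [set [set a; b]; [set a; c]; [set a; d]; [set b; c]; [set b; d]; [set c; d]] ->
  (forall A, A \in E -> 2 < #|L A|) -> lcolorable E L.
Proof.
rewrite /= !inE !negb_or => /and4P[/and3P[ab ac ad] /andP[bc bd] cd _] EE LE.
have inE' A : A \in [:: [set a; b]; [set a; c]; [set a; d]; [set b; c]; [set b; d]; [set c; d]] ->
    A \in E.
  by rewrite EE !inE -!orbA.
have Ein A : A \in E -> A \in [:: [set a; b]; [set a; c]; [set a; d]; [set b; c]; [set b; d]; [set c; d]].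
  by rewrite EE !inE -!orbA.
have mem A : A \in [:: [set a; b]; [set a; c]; [set a; d]; [set b; c]; [set b; d]; [set c; d]] ->
  2 < #|L A| by move/inE'/LE.
have [||||||p [q [pL qL [H1 H2 H3 H4]]]] := @opposite_pair_colors _ (L [set a; b])
    (L [set c; d]) (L [set a; c]) (L [set a; d]) (L [set b; c]) (L [set b; d]);
  try by apply: mem; rewrite !inE eqxx ?orbT.
have abE : [set a; b] \in E by apply: inE'; rewrite mem_head.
have ncd : [set c; d] != [set a; b].
  by apply/eqP => /setP/(_ a); rewrite !inE eqxx (negbTE ac) (negbTE ad).
apply: (lcolorable_extend abE pL).
have cdE : [set c; d] \in E :\ [set a; b].
  by rewrite in_setD1 ncd; apply: inE'; rewrite !inE eqxx !orbT.
apply: (lcolorable_extend (A := [set c; d]) (q := q)) => //.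
  rewrite mem_strike qL meet2 !inE (negbTE ac) (negbTE ad) (negbTE bc) (negbTE bd).
  by [].
set F := _ :\ _; set L' := strike _ _ _.
have Fin A : A \in F -> A \in [:: [set a; c]; [set a; d]; [set b; c]; [set b; d]].
  rewrite !in_setD1 => /and3P[n1 n2 /Ein]; rewrite !inE (negbTE n1) (negbTE n2) /= orbF.
  by rewrite -?orbA.
have L'L A : L A :\ p :\ q \subset L' A.
  apply/subsetP => z; rewrite !mem_strike !inE => /and3P[-> -> ->].
  by rewrite !implybT.
have L'2 A : A \in F -> 1 < #|L' A|.
  by move/Fin; rewrite !inE => /or4P[]/eqP ->;
    apply: leq_trans (subset_leq_card (L'L _)).
have FX : bipartite [set a; b] F.
  move=> A /Fin; rewrite !inE => /or4P[]/eqP ->;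
  [exists a, c | exists a, d | exists b, c | exists b, d];
  by rewrite !inE !eqxx ?orbT ?negb_or ?[c == _]eq_sym ?[d == _]eq_sym ?ac ?ad ?bc ?bd.
apply: (bipartite_rooted (k := 2) (r := a) q0 FX).
  move=> v.
  have two (A1 A2 : {set T}) : (forall A, A \in F -> v \in A -> (A == A1) || (A == A2)) -> vdeg F v <= 2.
    move=> H; apply: (leq_trans (subset_leq_card (_ : _ \subset [set A1; A2]))).
      by apply/subsetP => A; rewrite inE in_set2 => /andP[]; exact: H.
    by rewrite cards2; case: eqP.
  have [va|va] := eqVneq v a.
    apply: (two [set a; c] [set a; d]) => A /Fin; rewrite va !inE => /or4P[]/eqP ->;
    by rewrite ?eqxx ?orbT // !inE (negbTE ab) ?(negbTE ac) ?(negbTE ad).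
  have [vb|vb] := eqVneq v b.
    apply: (two [set b; c] [set b; d]) => A /Fin; rewrite vb !inE => /or4P[]/eqP ->;
    by rewrite ?eqxx ?orbT // !inE eq_sym (negbTE ab) ?(negbTE bc) ?(negbTE bd).
  have [vc|vc] := eqVneq v c.
    apply: (two [set a; c] [set b; c]) => A /Fin; rewrite vc !inE => /or4P[]/eqP ->;
    by rewrite ?eqxx ?orbT // !inE (negbTE cd) orbF eq_sym ?(negbTE ac) ?(negbTE bc).
  apply: (two [set a; d] [set b; d]) => A /Fin; rewrite !inE => /or4P[]/eqP ->;
  by rewrite ?eqxx ?orbT // !inE (negbTE vc) ?(negbTE va) ?(negbTE vb).
move=> A AF; case: ifP => _; last exact: L'2.
apply: leq_trans (L'2 _ AF).
apply: (leq_trans (subset_leq_card (_ : _ \subset [set [set a; c]; [set a; d]]))).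
  apply/subsetP => B; rewrite inE => /andP[/Fin]; rewrite !inE => /or4P[]/eqP ->;
  by rewrite ?eqxx ?orbT // !inE (negbTE ab) ?(negbTE ac) ?(negbTE ad).
by rewrite cards2; case: eqP.
Qed.

(** Colouring [uv] costs every other edge at most one colour, matching the drop of the degree bound
    to [k - 1]; only the lists at the root need care. If [r] lies on [uv], its degree drops too. If
    at most one edge at [r] meets [uv], the colour of [uv] is chosen to spare it. *)
Lemma theta_colorable E L k u v r X : 2 < k -> two_uniform E ->
  [set u; v] \in E -> u != v -> bipartite X (E :\ [set u; v]) ->
  (forall w, w != u -> w != v -> vdeg E w <= 2) -> (forall w, vdeg E w <= k) ->
  (forall A, A \in E -> (if r \in A then vdeg E r else k) <= #|L A|) ->
  lcolorable E L.
Proof.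
move=> k3 E2 fE uv FX d2 dk LE; set f := [set u; v] in fE FX *; set F := E :\ f.
have FE B : B \in F -> B \in E by rewrite inE => /andP[].
have meetf B : (f :&: B != set0) = (u \in B) || (v \in B) by exact: meet2.
have dF w : vdeg F w <= k - 1.
  have := dk w; rewrite (vdegD1 w fE) !inE -/F.
  have [wu|wu] := eqVneq w u; first by nat_lia.
  have [wv|wv] := eqVneq w v; first by nat_lia.
  by have := d2 w wu wv; have := vdegS w (subsetDl E [set f]); rewrite -/F; nat_lia.
have useF q : q \in L f ->
    (forall B, B \in F -> r \in B -> vdeg F r <= #|strike L f q B|) -> lcolorable E L.
  move=> qf H; apply: (lcolorable_extend fE qf).
  apply: (bipartite_rooted (k := k - 1) (r := r) q0 FX dF) => B BF.
  case: ifP => rB; first exact: H.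
  have := LE B (FE _ BF); rewrite rB; have := card_strike L f q B.
  by case: (_ != _) => /=; nat_lia.
have [rf|rf] := boolP (r \in f).
  have /card_gt0P[q qf] : 0 < #|L f|.
    by apply: leq_trans (LE _ fE); rewrite rf (vdeg_gt0 fE).
  apply: (useF q qf) => B BF rB; have := LE B (FE _ BF).
  rewrite rB (vdegD1 r fE) rf -/F; have := card_strike L f q B.
  by case: (_ != _) => /=; nat_lia.
have Lf : 2 < #|L f| by have := LE _ fE; rewrite (negbTE rf); nat_lia.
have ru : r != u by apply: contraNneq rf => ->; rewrite !inE eqxx.
have rv : r != v by apply: contraNneq rf => ->; rewrite !inE eqxx orbT.
have dr := d2 r ru rv.
have dFr : vdeg F r = vdeg E r by rewrite (vdegD1 r fE) (negbTE rf).
have useA A0 : (forall B, B \in F -> r \in B -> f :&: B != set0 -> B = A0) -> lcolorable E L.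
  move=> H.
  (* A list with more than two colours can afford any loss, as [r] has degree at most two; a smaller
     one cannot exhaust the at least three colours of [L f]. *)
  have [q qf qA] : exists2 q, q \in L f & minn 2 #|L A0| <= #|L A0 :\ q|.
    have [big|small] := ltnP 2 #|L A0|.
      have /card_gt0P[q qf] : 0 < #|L f| by nat_lia.
      by exists q => //; have := card_D1_leq (L A0) q; nat_lia.
    have [|q qf] := @pick_color _ (L f) (enum (L A0)); first by rewrite -cardE; nat_lia.
    rewrite mem_enum => qA; exists q => //.
    by have := cardsD1 q (L A0); rewrite (negbTE qA); nat_lia.
  apply: (useF q qf) => B BF rB; have := LE B (FE _ BF); rewrite rB dFr /strike.
  by case: ifP => // /(H B BF rB) ->; nat_lia.
have card2 B x y : B \in E -> x \in B -> y \in B -> x != y -> B = [set x; y].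
  by move=> BE; apply: card2_pair; apply: E2.
have [urE|urE] := boolP ([set u; r] \in E); last first.
  apply: (useA [set v; r]) => B BF rB; rewrite meetf => /orP[uB|vB].
    by rewrite -(card2 B u r) ?FE // 1?eq_sym // in urE.
  by apply: card2; rewrite ?FE // eq_sym.
have [vrE|vrE] := boolP ([set v; r] \in E); last first.
  apply: (useA [set u; r]) => B BF rB; rewrite meetf => /orP[uB|vB].
    by apply: card2; rewrite ?FE // eq_sym.
  by rewrite -(card2 B v r) ?FE // 1?eq_sym // in vrE.
(* From now on [r] is the middle of a path of length two between [u] and [v]. *)
have fur : [set u; r] != f.
  by apply: contraNneq rf => <-; rewrite !inE eqxx orbT.
have fvr : [set v; r] != f.
  by apply: contraNneq rf => <-; rewrite !inE eqxx orbT.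
have urvr : [set v; r] != [set u; r].
  apply/eqP => /setP/(_ u); rewrite !inE eqxx (negbTE uv) eq_sym (negbTE ru) //.
have vrE' : [set v; r] \in E :\ [set u; r] by rewrite in_setD1 urvr.
have fE' : f \in E :\ [set u; r] :\ [set v; r].
  by rewrite !in_setD1 ![f == _]eq_sym fvr fur.
set G := E :\ [set u; r] :\ [set v; r] :\ f.
have GF : G \subset F.
  by apply/subsetP => B; rewrite !in_setD1 => /and4P[-> _ _ ->].
have GE B : B \in G -> B \in E by move/(subsetP GF)/FE.
have degG w : vdeg E w = (w \in [set u; r]) + ((w \in [set v; r]) + ((w \in f) + vdeg G w)).
  by rewrite (vdegD1 w urE) (vdegD1 w vrE') (vdegD1 w fE').
have rG B : B \in G -> r \notin B.
  move=> BG; apply/negP => rB; have := vdeg_gt0 BG rB; have := degG r.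
  by move: dr; rewrite !inE !eqxx !orbT; nat_lia.
have uvG B : B \in G -> u \in B -> v \in B -> False.
  move=> BG uB vB; have := card2 B u v (GE _ BG) uB vB uv.
  by move: BG; rewrite in_setD1 => /andP[/eqP].
have degu : vdeg E u = 2 + vdeg G u.
  by rewrite degG !inE !eqxx (negbTE uv) eq_sym (negbTE ru).
have degv : vdeg E v = 2 + vdeg G v.
  by rewrite degG !inE !eqxx [v == u]eq_sym (negbTE uv) [v == r]eq_sym (negbTE rv).
have Lur : 1 < #|L [set u; r]|.
  apply: leq_trans (LE _ urE); rewrite !inE eqxx orbT degG !inE !eqxx !orbT; nat_lia.
have Lvr : 1 < #|L [set v; r]|.
  apply: leq_trans (LE _ vrE); rewrite !inE eqxx orbT degG !inE !eqxx !orbT; nat_lia.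
have LG B : B \in G -> k <= #|L B|.
  by move=> BG; have := LE B (GE _ BG); rewrite (negbTE (rG _ BG)).
have start a b c : a \in L [set u; r] -> b \in L [set v; r] -> c \in L f -> uniq [:: a; b; c] ->
    lcolorable G (strike (strike (strike L [set u; r] a) [set v; r] b) f c) -> lcolorable E L.
  move=> aL bL cL; rewrite /= !inE negb_or andbT => /andP[/andP[ab ac] bc] H.
  apply: (lcolorable_extend urE aL); apply: (lcolorable_extend (q := b) vrE').
    by rewrite mem_strike bL [b == a]eq_sym ab implybT.
  apply: (lcolorable_extend (q := c) fE') => //.
  by rewrite !mem_strike cL ![c == _]eq_sym ac bc !implybT.
(* An edge of [G] at [u] meets [ur] and [uv] but not [vr], symmetrically at [v], and the others meet
   none of the three; hence a loss of two or none. *)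
have strikeG a b c B : B \in G ->
    #|L B| <= #|strike (strike (strike L [set u; r] a) [set v; r] b) f c B| +
      ((u \in B) || (v \in B)).*2.
  move=> BG; set L1 := strike L _ a; set L2 := strike L1 _ b.
  have := card_strike L [set u; r] a B; have := card_strike L1 [set v; r] b B.
  have := card_strike L2 f c B; rewrite !meet2 (negbTE (rG _ BG)) -/L1 -/L2 !orbF.
  by move: (uvG B BG); case: (u \in B); case: (v \in B) => H; try (by case: H); rewrite /= ?addn0 ?addn1; nat_lia.
have GX := bipartiteS GF FX.
(* For [k] at least 4 a greedy colouring of the three edges is enough: the degrees of [u] and [v]
   drop by two, and the remaining degrees are at most 2, hence at most [k - 2]. *)
have [k4|k4] := ltnP 3 k.
  have [a aL _] := @pick_color _ (L [set u; r]) [::] (ltnW Lur).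
  have [b bL] := @pick_color _ (L [set v; r]) [:: a] Lvr; rewrite !inE => ba.
  have [c cL] := @pick_color _ (L f) [:: a; b] Lf; rewrite !inE negb_or => /andP[ca cb].
  apply: (start a b c aL bL cL).
    by rewrite /= !inE negb_or ![a == _]eq_sym [b == c]eq_sym ba ca cb.
  apply: (bipartite_rooted (k := k - 2) (r := r) q0 GX) => [w|B BG].
    have := degG w; have := dk w.
    have [->|wu] := eqVneq w u; first by nat_lia.
    have [->|wv] := eqVneq w v; first by nat_lia.
    by have := d2 w wu wv; nat_lia.
  rewrite (negbTE (rG _ BG)); have := strikeG a b c B BG; have := LG _ BG.
  by case: (_ || _) => /=; nat_lia.
have ek : k = 3 by nat_lia.
have Gu : vdeg G u <= 1 by have := dk u; nat_lia.
have Gv : vdeg G v <= 1 by have := dk v; nat_lia.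
have dG2 w : vdeg G w <= 2.
  have [->|wu] := eqVneq w u; first by nat_lia.
  have [->|wv] := eqVneq w v; first by nat_lia.
  by have := degG w; have := d2 w wu wv; nat_lia.
(* With [k = 3], [u] and [v] have at most one further edge each. If these meet in [s], the diamond
   on [u], [v], [r], [s] is coloured at once, and the remaining edges touch none of its vertices. *)
have [/existsP[s /andP[usG vsG]]|/existsPn nos] :=
    boolP [exists s, ([set u; s] \in G) && ([set v; s] \in G)].
  have us : u != s.
    by apply/eqP => e; have := E2 _ (GE _ usG); rewrite e setUid cards1.
  have vs : v != s.
    by apply/eqP => e; have := E2 _ (GE _ vsG); rewrite e setUid cards1.
  have rs : r != s.
    by apply/eqP => e; have := rG _ usG; rewrite e !inE eqxx orbT.
  have [|||||a [b [c [x [y [[aL bL cL xL yL] [u1 [u2 [u3 xy]]]]]]]]] :=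
    @diamond_colors _ (L [set u; r]) (L [set v; r]) (L f) (L [set u; s]) (L [set v; s]).
  - by [].
  - by [].
  - by [].
  - by have := LG _ usG; nat_lia.
  - by have := LG _ vsG; nat_lia.
  apply: (start a b c aL bL cL u1).
  move: u2 u3; rewrite /= !inE !negb_or !andbT => /andP[/andP[ac ax] cx] /andP[/andP[bc byy] cy].
  have usvs : [set v; s] != [set u; s].
    apply/eqP => /setP/(_ u); rewrite !inE eqxx (negbTE uv) (negbTE us) //.
  have vsG' : [set v; s] \in G :\ [set u; s] by rewrite in_setD1 usvs.
  apply: (lcolorable_extend (q := x) usG).
    rewrite !mem_strike xL ![x == _]eq_sym ax cx !implybT /= meet2 !inE.
    by rewrite [v == u]eq_sym (negbTE uv) (negbTE vs) (negbTE ru) (negbTE rs).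
  apply: (lcolorable_extend (q := y) vsG').
    rewrite !mem_strike yL ![y == _]eq_sym byy cy xy !implybT /= meet2 !inE.
    by rewrite (negbTE uv) (negbTE us) (negbTE rv) (negbTE rs).
  set H := _ :\ _ :\ _; set L' := strike _ _ _.
  have HG : H \subset G by apply/subsetP => B; rewrite !in_setD1 => /and3P[].
  have degH w : vdeg G w = (w \in [set u; s]) + ((w \in [set v; s]) + vdeg H w).
    by rewrite (vdegD1 w usG) (vdegD1 w vsG').
  have free B : B \in H -> [/\ u \notin B, v \notin B, s \notin B & r \notin B].
    move=> BH; split; last exact: rG (subsetP HG _ BH).
    - apply/negP => uB; have := vdeg_gt0 BH uB; have := degH u.
      by rewrite !inE eqxx; nat_lia.
    - apply/negP => uB; have := vdeg_gt0 BH uB; have := degH v.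
      by rewrite !inE eqxx; nat_lia.
    - apply/negP => uB; have := vdeg_gt0 BH uB; have := degH s; have := degG s.
      have := d2 s; rewrite eq_sym us eq_sym vs => /(_ isT isT).
      by rewrite !inE eqxx !orbT; nat_lia.
  apply: (bipartite_rooted (k := 2) (r := r) q0 (bipartiteS HG GX)) => [w|B BH].
    by have := degH w; have := dG2 w; nat_lia.
  case: (free B BH) => uB vB sB rB; rewrite (negbTE rB) /L' /strike !meet2.
  rewrite (negbTE uB) (negbTE vB) (negbTE sB) (negbTE rB) /=.
  by have := LG _ (subsetP HG _ BH); nat_lia.
have [a aL _] := @pick_color _ (L [set u; r]) [::] (ltnW Lur).
have [b bL] := @pick_color _ (L [set v; r]) [:: a] Lvr; rewrite !inE => ba.
have [c cL] := @pick_color _ (L f) [:: a; b] Lf; rewrite !inE negb_or => /andP[ca cb].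
apply: (start a b c aL bL cL).
  by rewrite /= !inE negb_or ![a == _]eq_sym [b == c]eq_sym ba ca cb.
have := strikeG a b c; set L3 := strike _ f c => L3P.
(* Edges of [G] at [u] or [v] may be down to one colour, but only one root is allowed. The edge [B0]
   at [v], if any, is coloured beforehand and [u] becomes the root; [B0] misses the edge at [u],
   since a common vertex would be an [s] as excluded above. *)
have [B0 /andP[B0G vB0]|novG] := pickP [pred B in G | v \in B]; last first.
  apply: (bipartite_rooted (k := 2) (r := u) q0 GX dG2) => B BG.
  have vB : v \notin B by have := novG B; rewrite /= BG => /= ->.
  have := L3P B BG; have := LG _ BG; rewrite (negbTE vB) orbF.
  by case: (u \in B) => /=; nat_lia.
have /card_gt0P[d dL] : 0 < #|L3 B0|.
  have := L3P B0 B0G; have := LG _ B0G; rewrite vB0 orbT /=; nat_lia.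
apply: (lcolorable_extend B0G dL).
set H := G :\ B0.
have HG : H \subset G by apply: subsetDl.
apply: (bipartite_rooted (k := 2) (r := u) q0 (bipartiteS HG GX)) => [w|B BH].
  exact: leq_trans (vdegS _ HG) (dG2 w).
have BG := subsetP HG _ BH.
have vB : v \notin B.
  by apply/negP => vB; have := vdeg_gt0 BH vB; have := vdegD1 v B0G; rewrite vB0 -/H; nat_lia.
have uB0 : u \notin B0 by apply/negP => uB0; apply: uvG B0G uB0 vB0.
have := L3P B BG; have := LG _ BG; have := card_strike L3 B0 d B; rewrite (negbTE vB) orbF.
have [uB|uB] := boolP (u \in B); last by case: (_ != _) => /=; nat_lia.
suff -> : B0 :&: B = set0.
  by have := vdegS u HG; rewrite eqxx /=; nat_lia.
apply/eqP/contraT => /set0Pn[s]; rewrite inE => /andP[sB0 sB].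
have us : u != s by apply: contraNneq uB0 => ->.
have vs : v != s by apply: contraNneq vB => ->.
have := nos s; rewrite -(card2 _ _ _ (GE _ BG) uB sB us).
by rewrite -(card2 _ _ _ (GE _ B0G) vB0 sB0 vs) BG B0G.
Qed.

End Blocks.

(** * From edge sets to graphs, and separation at cut vertices *)

Section EdgeRelation.
Variable T : finType.
Implicit Types (E F : {set {set T}}) (A B X : {set T}) (u v w x y r s t : T).

Definition edge_rel E x y := (x != y) && ([set x; y] \in E).

Lemma edge_rel_sym E : symmetric (edge_rel E).
Proof. by move=> x y; rewrite /edge_rel eq_sym setUC. Qed.

Lemma edge_rel_irr E : irreflexive (edge_rel E).
Proof. by move=> x; rewrite /edge_rel eqxx. Qed.

Lemma odd_cycle_sub (e1 e2 : rel T) C : subrel e1 e2 -> odd_cycle e1 C -> odd_cycle e2 C.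
Proof.
rewrite /odd_cycle /is_cycle /ucycleb => e12 /andP[/andP[/andP[cC ->] ->] ->].
by rewrite !andbT; case: C cC => //= x p; apply: sub_path.
Qed.

Lemma in_Gstar_sub (e1 e2 : rel T) : subrel e1 e2 -> in_Gstar e2 -> in_Gstar e1.
Proof.
by move=> e12 G2 p q /(odd_cycle_sub e12) op /(odd_cycle_sub e12) oq; apply: G2.
Qed.

Lemma cycle_edges_edge_rel E C A : odd_cycle (edge_rel E) C -> A \in cycle_edges C -> A \in E.
Proof.
case/andP => /andP[/andP[cC _] _] _ /imsetP[x xC ->].
by have /andP[] := next_cycle cC xC.
Qed.

Lemma two_uniform_edge E A x : two_uniform E -> A \in E -> x \in A ->
  exists2 y, A = [set x; y] & edge_rel E x y.
Proof.
move=> E2 AE xA; have /cards2P[a [b [ab EA]]] := introT eqP (E2 _ AE).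
move: xA AE; rewrite EA !inE => /orP[]/eqP-> abE.
  by exists b; rewrite // /edge_rel ab.
by exists a; rewrite 1?setUC // /edge_rel eq_sym ab setUC.
Qed.

Lemma vdeg_neighbours E x : two_uniform E -> vdeg E x <= #|[set z | edge_rel E x z]|.
Proof.
move=> E2; apply: leq_trans (leq_imset_card (fun z => [set x; z]) _).
apply: subset_leq_card; apply/subsetP => A; rewrite inE => /andP[AE xA].
have [y -> exy] := two_uniform_edge E2 AE xA.
by apply: imset_f; rewrite inE.
Qed.

Lemma two_uniformS E F : F \subset E -> two_uniform E -> two_uniform F.
Proof. by move=> /subsetP FE H A /FE/H. Qed.

Lemma edge_relS E F : F \subset E -> subrel (edge_rel F) (edge_rel E).
Proof. by move=> /subsetP FE x y /andP[xy /FE]; rewrite /edge_rel xy. Qed.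

Lemma odd_cycle_or_bipartite E : two_uniform E ->
  (exists C, odd_cycle (edge_rel E) C) \/ exists X, bipartite X E.
Proof.
move=> E2; have [?|[X HX]] := odd_cycle_or_bipartition (edge_rel_sym E) (edge_rel_irr E).
  by left.
right; exists X => A AE; have /cards2P[a [b [ab EA]]] := introT eqP (E2 _ AE).
have eab : edge_rel E a b by rewrite /edge_rel ab -EA.
have := HX _ _ eab; rewrite EA.
have [aX bX|aX] := boolP (a \in X); first by exists a, b; split=> //; move: bX; case: (b \in X).
by case: (boolP (b \in X)) => // bX _; exists b, a; rewrite setUC.
Qed.

(** If deleting [v] separates [x] from [y], let [S] be the component of [x]. An edge meeting [S] has
    its ends in [S] or at [v], so it can share only [v] with an edge missing [S]. *)
Lemma nonseparable_or_separation E : two_uniform E -> nonseparable (edge_rel E) \/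
  exists v (E1 E2 : {set {set T}}),
    [/\ E1 :|: E2 = E, [disjoint E1 & E2], E1 != set0 & E2 != set0] /\
    (forall A B x, A \in E1 -> B \in E2 -> x \in A -> x \in B -> x = v).
Proof.
move=> U2; pose e v := fun a b => [&& a != v, b != v & edge_rel E a b].
have [H|] := boolP [forall v, forall x, forall y, forall x', forall y',
    [==> x != v, y != v, edge_rel E x x', edge_rel E y y' => connect (e v) x y]].
  left=> v x y x' y' xv yv exx' eyy'.
  move/forallP/(_ v)/forallP/(_ x)/forallP/(_ y)/forallP/(_ x')/forallP/(_ y'): H.
  by rewrite xv yv exx' eyy'.
case/forallPn => v /forallPn[x /forallPn[y /forallPn[x' /forallPn[y']]]].
rewrite !negb_imply => /and5P[xv yv exx' eyy' nxy].
pose S := [set a | connect (e v) x a].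
have Sv : v \notin S.
  rewrite inE; apply/negP => /connectP[p]; case/lastP: p => [_ /= vx|p z].
    by rewrite vx eqxx in xv.
  by rewrite rcons_path last_rcons => /andP[_ /and3P[_ zv _]] vz; rewrite vz eqxx in zv.
have Se a b : a \in S -> b != v -> edge_rel E a b -> b \in S.
  move=> aS bv eab; move: (aS); rewrite !inE => xa; apply: connect_trans xa (connect1 _).
  by rewrite /e bv eab !andbT; apply: contraNneq Sv => <-.
right; exists v, [set A in E | A :&: S != set0], [set A in E | A :&: S == set0].
have Sx : x \in S by rewrite inE connect0.
split; first split.
- by apply/setP => A; rewrite !inE -andb_orr orNb andbT.
- by rewrite disjoints_subset; apply/subsetP => A; rewrite !inE => /andP[-> ->].
- apply/set0Pn; exists [set x; x']; rewrite inE meet2 Sx /= andbT.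
  by case/andP: exx'.
- have Sy : y \notin S by rewrite inE.
  apply/set0Pn; exists [set y; y']; case/andP: (eyy') => yy' yE; rewrite inE yE /=.
  rewrite -[_ == _]negbK meet2 negb_or Sy /=; apply: contra Sy => y'S.
  by apply: Se y'S yv _; rewrite edge_rel_sym.
move=> A B z; rewrite !inE => /andP[AE AS] /andP[BE /eqP BS] zA zB.
have zS : z \notin S.
  by apply/negP => zS; have : z \in B :&: S by [rewrite inE zB zS]; rewrite BS inE.
apply/eqP; apply: contraNT zS => zv.
have [t EA ezt] := two_uniform_edge U2 AE zA.
move: AS; rewrite EA meet2 => /orP[//|tS].
by apply: Se tS zv _; rewrite edge_rel_sym.
Qed.

End EdgeRelation.

Section Gluing.
Variables (T Q : finType).
Implicit Types (E F : {set {set T}}) (L : {set T} -> {set Q}).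

Lemma vdegU E1 E2 (v : T) : [disjoint E1 & E2] -> vdeg (E1 :|: E2) v = vdeg E1 v + vdeg E2 v.
Proof.
move=> dE; rewrite /vdeg -cardsUI [X in _ + X](_ : _ = 0) ?addn0.
  by apply: eq_card => A; rewrite !inE andb_orl.
apply: eq_card0 => A; rewrite !inE; apply/negP => /andP[/andP[A1 _] /andP[A2 _]].
by rewrite (disjointFr dE A1) in A2.
Qed.

(** The parts interact only at [v], through the colours [E1] uses there. Only their number is
    controlled, so [E2] must be colourable whichever set of that size is removed. *)
Lemma lcolorable_glue E1 E2 L (v : T) : [disjoint E1 & E2] ->
  (forall A B x, A \in E1 -> B \in E2 -> x \in A -> x \in B -> x = v) ->
  lcolorable E1 L ->
  (forall S : {set Q}, #|S| <= vdeg E1 v ->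
     lcolorable E2 (fun B => if v \in B then L B :\: S else L B)) ->
  lcolorable (E1 :|: E2) L.
Proof.
move=> dE share [c1 [c1P c1L]] H2.
pose S := c1 @: [set A in E1 | v \in A].
have [c2 [c2P c2L]] := H2 S (leq_imset_card _ _).
have ne A B : A \in E1 -> B \in E2 -> A :&: B != set0 -> c1 A != c2 B.
  move=> A1 B2 /set0Pn[x]; rewrite inE => /andP[xA xB].
  have xv := share _ _ _ A1 B2 xA xB; rewrite xv in xA xB.
  have := c2L _ B2; rewrite xB inE => /andP[nS _].
  by apply: contraNneq nS => <-; apply: imset_f; rewrite inE A1.
exists (fun A => if A \in E1 then c1 A else c2 A); split=> [A B|A]; rewrite !inE.
  have [A1 _|A1 /= A2] := boolP (A \in E1); have [B1 _|B1 /= B2] := boolP (B \in E1) => nAB m.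
  - exact: c1P.
  - exact: ne.
  - by rewrite eq_sym; apply: ne => //; rewrite setIC.
  - exact: c2P.
have [A1 _|_ /= A2] := boolP (A \in E1); first exact: c1L.
by have := c2L _ A2; case: ifP => // _; rewrite inE => /andP[].
Qed.

End Gluing.

Section Main.
Variables (T Q : finType) (q0 : Q).
Implicit Types (E F : {set {set T}}) (L : {set T} -> {set Q}).

(* Induction along the block tree: [r] is the cut vertex at which a block is attached to
   the part of the graph that has been coloured before. *)
Lemma rooted_colorable k r E L : 2 < k -> two_uniform E -> in_Gstar (edge_rel E) ->
  (forall w, vdeg E w <= k) ->
  (forall A, A \in E -> (if r \in A then vdeg E r else k) <= #|L A|) ->
  lcolorable E L.
Proof.
move=> k3; move En: #|E| => n; elim/ltn_ind: n r E L En => n IH r E L En U2 GE dE LE.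
have [ns|] := nonseparable_or_separation U2; last first.
  case=> v [E1 [E2 [[EE dis n1 n2] share]]].
  (* [E1] is coloured first and keeps the root [r], while [E2] gets the root [v]; by exchanging the
     parts, [r] does not occur in [E2] unless it is [v]. *)
  wlog rv : E1 E2 EE dis n1 n2 share / r = v \/ forall A, A \in E2 -> r \notin A.
    move=> W; have [rv|rv] := eqVneq r v; first by apply: W EE dis n1 n2 share _; left.
    have [/existsP[A /andP[A2 rA]]|/existsPn nA] := boolP [exists A, (A \in E2) && (r \in A)].
      apply: (W E2 E1) => //; rewrite 1?setUC 1?disjoint_sym //.
        by move=> B C x B2 C1 xB xC; apply: share C1 B2 xC xB.
      right=> B B1; apply/negP => rB.
      by have := share _ _ _ B1 A2 rB rA; apply/eqP.
    apply: (W E1 E2) => //; right=> A A2; have := nA A; by rewrite A2.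
  have s1 : E1 \subset E by rewrite -EE subsetUl.
  have s2 : E2 \subset E by rewrite -EE subsetUr.
  have cE : #|E1| + #|E2| = n.
    by rewrite -En -EE -cardsUI disjoint_setI0 // cards0 addn0.
  have l1 : #|E1| < n by move: n2; rewrite -card_gt0; lia.
  have l2 : #|E2| < n by move: n1; rewrite -card_gt0; lia.
  have sub F : F \subset E -> [/\ two_uniform F, in_Gstar (edge_rel F) & forall w, vdeg F w <= k].
    move=> FE; split; first exact: two_uniformS FE U2.
      exact: in_Gstar_sub (edge_relS FE) GE.
    by move=> w; apply: leq_trans (vdegS w FE) (dE w).
  rewrite -EE; apply: (lcolorable_glue (v := v)) => //.
    have [u1 g1 d1] := sub _ s1.
    apply: (IH _ l1 r E1 L erefl u1 g1 d1) => A A1.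
    have := LE A (subsetP s1 _ A1); case: ifP => // _.
    by apply: leq_trans; apply: vdegS.
  (* Degrees at [v] add up over the two parts, to at most [k]. Removing [vdeg E1 v] colours
     therefore leaves at least [vdeg E2 v], also when [v = r] and the list had only [vdeg E r]
     colours. *)
  move=> S cS; have [u2 g2 d2] := sub _ s2.
  apply: (IH _ l2 v E2 _ erefl u2 g2 d2) => B B2.
  have := LE B (subsetP s2 _ B2); case: ifP => [rB|rB] LB; case: ifP => vB //.
  - case: rv => [rv|/(_ _ B2)]; last by rewrite rB.
    have := vdegU v dis; rewrite EE; move: LB; rewrite rv => LB eV.
    have := cardsD (L B) S; have := subset_leq_card (subsetIr (L B) S).
    by clear -LB eV cS; lia.
  - case: rv => [rv|/(_ _ B2)]; last by rewrite rB.
    by rewrite rv vB in rB.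
  - have := vdegU v dis; rewrite EE => eV; have := dE v.
    have := cardsD (L B) S; have := subset_leq_card (subsetIr (L B) S).
    by clear -LB eV cS; lia.
have e_sym := edge_rel_sym E; have e_irr := edge_rel_irr E.
have [oddC|[X HX]] := odd_cycle_or_bipartite U2; last exact: bipartite_rooted HX dE LE.
have [/existsP[[a b] /existsP[[c d] /= K]]|/existsPn noK] :=
    boolP [exists p : T * T, [exists q : T * T, complete4 (edge_rel E) p.1 p.2 q.1 q.2]].
  have neq x y : edge_rel E x y -> x != y by case/andP.
  case/and5P: (K) => e1 e2 e3 e4 /andP[e5 e6].
  have span A x : A \in E -> x \in A -> x \in [:: a; b; c; d].
    move=> AE xA; have [y _ exy] := two_uniform_edge U2 AE xA.
    exact: complete4_spanning K exy.
  have ud : uniq [:: a; b; c; d].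
    by rewrite /= !inE !negb_or (neq _ _ e1) (neq _ _ e2) (neq _ _ e3) (neq _ _ e4) (neq _ _ e5) (neq _ _ e6).
  have mE x y : edge_rel E x y -> [set x; y] \in E by case/andP.
  have EE : E = [set [set a; b]; [set a; c]; [set a; d]; [set b; c]; [set b; d]; [set c; d]].
    apply/eqP; rewrite eqEsubset; apply/andP; split; apply/subsetP => A; last first.
      by rewrite !inE -!orbA => /or4P[|||/or3P[]] /eqP->; apply: mE.
    move=> AE; have /cards2P[x [y [xy EA]]] := introT eqP (U2 _ AE).
    have := span A x AE; have := span A y AE; rewrite EA set21 set22 => /(_ isT) my /(_ isT) mx.
    move: mx my xy; rewrite !inE => /or4P[]/eqP -> /or4P[]/eqP ->; rewrite ?eqxx // => _;
      rewrite ?(setUC [set b] [set a]) ?(setUC [set c] [set a]) ?(setUC [set d] [set a])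
        ?(setUC [set c] [set b]) ?(setUC [set d] [set b]) ?(setUC [set d] [set c]) ?eqxx ?orbT //.
  apply: (complete4_colorable q0 ud EE) => A AE; apply: leq_trans (LE _ AE).
  case: ifP => // rA.
  (* A root on K4 has degree three, so the lists at the root have three colours as well. *)
  have d3 x y z w : uniq [:: x; y; z; w] -> edge_rel E x y -> edge_rel E x z -> edge_rel E x w ->
      2 < vdeg E x.
    rewrite /= !inE !negb_or => /and4P[/and3P[xy xz xw] /andP[yz yw] zw _].
    move=> /andP[_ E1] /andP[_ E2] /andP[_ E3].
    have E2' : [set x; z] \in E :\ [set x; y].
      rewrite in_setD1 E2 andbT; apply/eqP => /setP/(_ z); rewrite !inE eqxx orbT.
      by rewrite [z == x]eq_sym (negbTE xz) [z == y]eq_sym (negbTE yz).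
    have E3' : [set x; w] \in E :\ [set x; y] :\ [set x; z].
      rewrite !in_setD1 E3 andbT; apply/andP; split; apply/eqP => /setP/(_ w);
        rewrite !inE eqxx orbT [w == x]eq_sym (negbTE xw) /=.
        by rewrite eq_sym (negbTE zw).
      by rewrite eq_sym (negbTE yw).
    by rewrite (vdegD1 x E1) (vdegD1 x E2') (vdegD1 x E3') !inE !eqxx.
  have perm3 x y z w : perm_eq [:: a; b; c; d] [:: x; y; z; w] -> uniq [:: x; y; z; w].
    by move/perm_uniq <-.
  have := span A r AE rA; rewrite !inE => /or4P[]/eqP ->.
  - exact: d3 ud e1 e2 e3.
  - apply: (d3 b a c d) => //; last by rewrite e_sym.
    by apply: perm3; apply/permP => f /=; clear; lia.
  - apply: (d3 c a b d); rewrite // 1?e_sym //.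
    by apply: perm3; apply/permP => f /=; clear; lia.
  - apply: (d3 d a b c); rewrite // 1?e_sym //.
    by apply: perm3; apply/permP => f /=; clear; lia.
case: oddC => C oC.
have noK' a b c d : ~~ complete4 (edge_rel E) a b c d.
  by have /existsPn/(_ (c, d)) := noK (a, b).
have [u [v [euv cap]]] := nonseparable_structure e_sym e_irr GE ns noK' oC.
have [uv fE] := andP euv.
have [[C' oC']|[X HX]] := odd_cycle_or_bipartite (two_uniformS (subsetDl E [set [set u; v]]) U2).
  have := captured_odd_cycle e_sym GE cap (odd_cycle_sub (edge_relS (subsetDl _ _)) oC').
  by move/(cycle_edges_edge_rel oC'); rewrite !inE eqxx.
apply: (theta_colorable q0 k3 U2 fE uv HX _ dE LE) => w wu wv.
apply: leq_trans (vdeg_neighbours w U2) _.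
have [->|/set0Pn[z]] := eqVneq [set z | edge_rel E w z] set0; first by rewrite cards0.
by rewrite inE => ewz; apply: captured_degree (cap _ _ ewz wu wv).
Qed.

End Main.

(** * Chromatic index *)

Section ChromaticIndex.
Variables (T : finType) (e : rel T).
Hypotheses (e_sym : symmetric e) (e_irr : irreflexive e).

Lemma edge_rel_edges : edge_rel (edges e) =2 e.
Proof.
move=> x y; apply/andP/idP => [[xy]|exy].
  rewrite inE => /existsP[a /existsP[b /andP[eab /eqP E]]].
  have := set21 x y; have := set22 x y; rewrite E !inE.
  by move=> /orP[]/eqP ye /orP[]/eqP xe; rewrite ye xe ?eqxx // in xy *; rewrite e_sym.
split; first by apply: contraTneq exy => ->; rewrite e_irr.
by rewrite inE; apply/existsP; exists x; apply/existsP; exists y; rewrite exy eqxx.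
Qed.

Lemma two_uniform_edges : two_uniform (edges e).
Proof.
move=> A; rewrite inE => /existsP[a /existsP[b /andP[eab /eqP ->]]].
by rewrite cards2; case: eqP eab => // ->; rewrite e_irr.
Qed.

Lemma edge_choosable_colorable k : edge_choosable e k -> edge_colorable e k.
Proof.
move=> /(_ (fun=> iota 0 k))[A _|c [cP cL]]; first by rewrite undup_id ?iota_uniq ?size_iota.
by exists c; split=> // A /cL; rewrite mem_iota.
Qed.

Lemma edge_colorable_vdeg j v : edge_colorable e j -> vdeg (edges e) v <= j.
Proof.
case=> c [cP cj]; rewrite -[j]subn0; apply: (@card_range _ _ c).
  move=> A B; rewrite !inE => /andP[AE vA] /andP[BE vB] cAB; apply/eqP/contraT => nAB.
  have := cP A B; rewrite !inE => /(_ AE BE nAB); rewrite cAB eqxx; apply.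
  by apply/set0Pn; exists v; rewrite inE vA.
by move=> A; rewrite inE => /andP[/cj].
Qed.

(* Two colours alternate along a cycle, so they cannot close up on an odd one. *)
Lemma edge_colorable_odd_cycle C j : odd_cycle e C -> edge_colorable e j -> 2 < j.
Proof.
move=> oC [c [cP cj]]; rewrite ltnNge; apply/negP => j2.
have uC := odd_cycle_uniq oC.
have sC : 2 < size C by case/andP: oC => /andP[].
have cC : cycle e C by case/andP: oC => /andP[/andP[]].
pose g x := c [set x; next C x] == 0.
have nextE x : x \in C -> [set x; next C x] \in edges e.
  move=> xC; have := edge_rel_edges x (next C x).
  by rewrite (next_cycle cC xC) => /andP[].
have alt x : x \in C -> g (next C x) = ~~ g x.
  move=> xC; have yC : next C x \in C by rewrite mem_next.
  have [_ _] := next_prev_edges uC sC yC.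
  rewrite prev_next // [X in _ != X]setUC => ne.
  have := cP _ _ (nextE _ yC) (nextE _ xC) ne.
  have -> : [set next C x; next C (next C x)] :&: [set x; next C x] != set0.
    by apply/set0Pn; exists (next C x); rewrite in_setI !in_set2 !eqxx orbT.
  move=> /(_ isT); rewrite /g; have := cj _ (nextE _ yC); have := cj _ (nextE _ xC).
  by move: (c _) (c _) j2 => m n; clear; case: m => [|[|m]]; case: n => [|[|n]] //=; lia.
(* Since [next C] permutes [C] and negates [g], as many vertices satisfy [g] as fail it, and the
   length is even. *)
have pC : perm_eq (map (next C) C) C.
  apply: uniq_perm => //.
    by rewrite map_inj_uniq //; apply: can_inj (prev_next uC).
  move=> x; apply/mapP/idP => [[y yC ->]|xC]; first by rewrite mem_next.
  by exists (prev C x); rewrite ?mem_prev // next_prev.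
have := permP pC g; rewrite count_map.
rewrite (eq_in_count (a2 := predC g)) => [cnt|x xC]; last exact: alt.
have := count_predC g C; rewrite cnt; case/andP: oC => _ + E.
by rewrite -E oddD addbb.
Qed.

(** Finitely many finite lists lie below a common bound, so the colours may be taken in a finite
    ordinal type. *)
Lemma edge_choosable_lcolorable k :
  (forall (Q : finType) (q0 : Q) (L : {set T} -> {set Q}),
     (forall A, A \in edges e -> k <= #|L A|) -> lcolorable (edges e) L) ->
  edge_choosable e k.
Proof.
move=> H L LP.
pose N := \max_(A : {set T}) \max_(i <- L A) i.
have LN A i : i \in L A -> i < N.+1.
  move=> iA; rewrite ltnS; apply: leq_trans (@leq_bigmax _ (fun B => \max_(j <- L B) j) A).
  by apply: leq_bigmax_seq.
have [A AE|c [cP cL]] := H 'I_N.+1 ord0 (fun A => [set q : 'I_N.+1 | val q \in L A]).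
  apply: leq_trans (LP _ AE) _; rewrite cardE -(size_map val).
  apply: uniq_leq_size (undup_uniq _) _ => i; rewrite mem_undup => iA.
  by apply/mapP; exists (Ordinal (LN _ _ iA)); rewrite ?mem_enum ?inE.
exists (fun A => val (c A)); split=> [A B AE BE nAB m|A AE].
  by have := cP A B AE BE nAB m.
by have := cL A AE; rewrite inE.
Qed.

End ChromaticIndex.

Theorem mainTheorem2 (T : finType) (e : rel T)
  (e_sym : symmetric e) (e_irr : irreflexive e) :
  in_Gstar e ->
  exists k, is_chromatic_index e k /\ is_list_chromatic_index e k.
Proof.
move=> Ge.
have E2 := two_uniform_edges e_irr.
have relE := edge_rel_edges e_sym e_irr.
suff [k kC kmin] : exists2 k, edge_choosable e k & forall j, edge_colorable e j -> k <= j.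
  exists k; split; split=> //; first exact: edge_choosable_colorable.
  by move=> j /edge_choosable_colorable/kmin.
pose D := \max_v vdeg (edges e) v.
have dD v : vdeg (edges e) v <= D by apply: leq_bigmax.
have Dmin j : edge_colorable e j -> D <= j.
  by move=> cj; apply/bigmax_leqP => v _; apply: edge_colorable_vdeg.
(* The edgeless case is split off so that a vertex [r] exists; the rooted lemmas ask for one,
   although no list is short at the start. *)
have [E0|/set0Pn[A0 A0E]] := eqVneq (edges e) set0.
  exists D => //; move=> L _; exists (fun=> 0).
  by split=> [A B|A]; rewrite E0 in_set0.
have /card_gt0P[r _] : 0 < #|A0| by rewrite (E2 _ A0E).
have [[C]|[X HX]] := odd_cycle_or_bipartite E2.
  move=> /(odd_cycle_sub (fun x y exy => etrans (esym (relE x y)) exy)) oC.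
  exists (maxn D 3) => [|j cj]; last first.
    by rewrite geq_max Dmin // (edge_colorable_odd_cycle e_sym e_irr oC cj).
  apply: edge_choosable_lcolorable => Q q0 L LP.
  apply: (rooted_colorable (k := maxn D 3) (r := r) q0 _ E2).
  - by rewrite leq_maxr.
  - by apply: in_Gstar_sub Ge => x y; rewrite relE.
  - by move=> v; apply: leq_trans (dD v) (leq_maxl _ _).
  - move=> A AE; apply: leq_trans (LP _ AE); case: ifP => // _.
    exact: leq_trans (dD r) (leq_maxl _ _).
exists D => //; apply: edge_choosable_lcolorable => Q q0 L LP.
apply: (bipartite_rooted (k := D) (r := r) q0 HX dD) => A AE.
by apply: leq_trans (LP _ AE); case: ifP.
Qed.
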